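(* Let $K$ be a field, let $S=K[X_1,\ldots,X_n]$ be the polynomial ring in $n$ variables with its natural $\mathbb{Z}^n$-grading, and let $M, N$ be bounded below $\mathbb{Z}^n$-graded $S$-modules. If $\operatorname{Tor}^S_p(M,N)\neq 0$ for some integer $p \ge 0$, then for every integer $i$ with $0\le i\le p$ the $K$-vector space dimension of $\operatorname{Tor}^S_i(M,N)$ is at least $\binom{p}{i}$.
   Context: The $\mathbb{Z}^n$-grading on $S$ is given by $\deg(X_i)=\varepsilon_i$, the $i$-th canonical basis vector of $\mathbb{Z}^n$, with $K$ in degree $0$. For $a=(a_1,\ldots,a_n)\in\mathbb{Z}^n$ let $|a|=a_1+\cdots+a_n$. A $\mathbb{Z}^n$-graded $S$-module $M$ is called bounded below if there exists $c\in\mathbb{Z}$ such that $M_a=0$ for all $a\in\mathbb{Z}^n$ with $|a|\le c$. The modules are not assumed to be finitely generated. *)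

(* Defs.v *)
From HB Require Import structures.
From mathcomp Require Import all_boot all_algebra.
From mathcomp Require Import boolp classical_sets functions cardinality.
From mathcomp Require Import freeg mpoly.

Set Implicit Arguments.
Unset Strict Implicit.
Unset Printing Implicit Defensive.

Import GRing.Theory Num.Theory.
Local Open Scope classical_set_scope.
Local Open Scope ring_scope.

Section Modules.
Variable R : comNzRingType.

Section Submodule.
Variable V : lmodType R.

Definition mk_submod (S : V -> bool) (Sc : submod_closed S) : submodClosed V :=
  HB.pack_for (submodClosed V) S (GRing.isSubmodClosed.Build R V S Sc).

Definition submod (U : submodClosed V) : Type := {x : V | x \in U}.

HB.instance Definition _ U := SubChoice.on (submod U).
HB.instance Definition _ U := [SubChoice_isSubLmodule of submod U by <:].

Fact gen_submod_closed (A : set V) :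
  submod_closed (fun x => `[< forall U : submodClosed V, A `<=` [set` U] -> x \in U >]).
Proof.
split=> [|a x y /asboolP Ux /asboolP Uy]; apply/asboolP => U AU.
  exact: rpred0.
by rewrite rpredD ?rpredZ //; [exact: Ux | exact: Uy].
Qed.

Definition gen_submod (A : set V) : submodClosed V :=
  mk_submod (gen_submod_closed A).

Section Quotient.
Variable U : submodClosed V.

(* submodClosed does not itself provide the zmodClosed structure that
   Quotient.quot asks for. *)
Fact submod_zmod_closed : zmod_closed (fun x : V => x \in U).
Proof.
split=> [|x y]; rewrite -!topredE /= ?rpred0 // => Ux Uy.
by rewrite -scaleN1r addrC rpredD // rpredZ.
Qed.

Definition zmod_of_submod : zmodClosed V :=
  HB.pack_for (zmodClosed V) (fun x : V => x \in U)
    (GRing.isZmodClosed.Build V _ submod_zmod_closed).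

Definition quotmod : Type := Quotient.quot zmod_of_submod.

HB.instance Definition _ := ZmodQuotient.on quotmod.

Definition quotmod_scale (a : R) (x : quotmod) : quotmod :=
  \pi_quotmod%qT (a *: repr x).

Lemma pi_quotmod_eq0 (x : V) : (\pi_quotmod%qT x == 0 :> quotmod) = (x \in U).
Proof.
have -> : (x \in U) = (x - 0 \in zmod_of_submod) by rewrite subr0.
rewrite Quotient.idealrBE.
by rewrite -(raddf0 (\pi_quotmod%qT : {additive V -> quotmod})).
Qed.

Lemma pi_quotmod_scale a (x : V) :
  \pi_quotmod%qT (a *: x) = quotmod_scale a (\pi_quotmod%qT x).
Proof.
apply/eqP; rewrite -subr_eq0 -raddfB -scalerBr /= pi_quotmod_eq0.
by rewrite rpredZ // -pi_quotmod_eq0 raddfB /= reprK subrr.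
Qed.

Fact quotmod_scaleA a b x :
  quotmod_scale a (quotmod_scale b x) = quotmod_scale (a * b) x.
Proof.
by elim/quotW: x => x; rewrite -!pi_quotmod_scale scalerA !pi_quotmod_scale reprK.
Qed.

Fact quotmod_scale1 : left_id 1 quotmod_scale.
Proof. by elim/quotW=> x; rewrite -pi_quotmod_scale scale1r. Qed.

Fact quotmod_scaleDr : right_distributive quotmod_scale +%R.
Proof.
move=> a; elim/quotW=> x; elim/quotW=> y.
by rewrite -raddfD -!pi_quotmod_scale scalerDr raddfD.
Qed.

Fact quotmod_scaleDl x : {morph quotmod_scale^~ x : a b / a + b}.
Proof.
by elim/quotW: x => x a b; rewrite -!pi_quotmod_scale scalerDl raddfD.
Qed.

HB.instance Definition _ := GRing.Zmodule_isLmodule.Build R quotmod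
  quotmod_scaleA quotmod_scale1 quotmod_scaleDr quotmod_scaleDl.

Definition quotproj (x : V) : quotmod := \pi_quotmod%qT x.

Fact quotproj_linear : linear quotproj.
Proof. by move=> a x y; rewrite /quotproj raddfD /= pi_quotmod_scale. Qed.

HB.instance Definition _ :=
  GRing.isLinear.Build R V quotmod *:%R quotproj quotproj_linear.

End Quotient.
End Submodule.

Section KerIm.
Variables (V W : lmodType R) (f : {linear V -> W}).

Fact ker_submod_closed : submod_closed (fun x => f x == 0).
Proof.
split=> [|a x y]; rewrite -!topredE /= ?raddf0 //.
by move=> /eqP fx /eqP fy; rewrite linearP fx fy scaler0 addr0.
Qed.

Definition ker_submod : submodClosed V := mk_submod ker_submod_closed.

Fact im_submod_closed : submod_closed (fun y => `[< range f y >]).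
Proof.
split=> [|a _ _ /asboolP[x _ <-] /asboolP[y _ <-]]; apply/asboolP.
  by exists 0; rewrite ?raddf0.
by exists (a *: x + y); rewrite ?linearP.
Qed.

Definition im_submod : submodClosed W := mk_submod im_submod_closed.

End KerIm.

Section HomologyAt.
Variables (A B C : lmodType R) (f : {linear A -> B}) (g : {linear B -> C}).

Fact boundary_submod_closed :
  submod_closed (fun z : submod (ker_submod g) => val z \in im_submod f).
Proof.
have h0 : (0 : B) \in im_submod f by exact: rpred0.
split=> [|a x y] //; rewrite -!topredE => fx fy.
have : a *: val x + val y \in im_submod f by rewrite rpredD ?rpredZ.
by [].
Qed.

Definition boundary_submod : submodClosed (submod (ker_submod g)) :=
  mk_submod boundary_submod_closed.

(* ker g / (im f `&` ker g), which is ker g / im f whenever g \o f = 0 *)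
Definition homology_at : lmodType R := quotmod boundary_submod.

End HomologyAt.

Definition homology (C : nat -> lmodType R)
    (d : forall i, {linear C i.+1 -> C i}) (i : nat) : lmodType R :=
  match i with
  | 0 => quotmod (im_submod (d 0%N))
  | j.+1 => homology_at (d j.+1) (d j)
  end.

Section Free.
Variables (I : choiceType) (V : lmodType R) (b : I -> V).

Fact fglift_linear : linear (fglift b : {freeg I / R} -> V).
Proof.
pose fb : {additive {freeg I / R} -> V} :=
  HB.pack (fglift b : {freeg I / R} -> V)
    (GRing.isZmodMorphism.Build _ _ _ (lift_is_additive b)).
have fbZ a D : fb (a *: D) = a *: fb D.
  rewrite -[in RHS](freeg_sumE D) [a *: D]/(fgscale a D) /fgscale !raddf_sum /=.
  by apply: eq_bigr => x _; rewrite !liftU scalerA.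
by move=> a D E; rewrite -[fglift b]/(fb : _ -> _) raddfD; congr (_ + _).
Qed.

HB.instance Definition _ :=
  GRing.isLinear.Build R {freeg I / R} V *:%R (fglift b) fglift_linear.

End Free.

Section Tensor.
Variables M N : lmodType R.

Definition tensor_rel : set {freeg (M * N)%type / R} := [set z |
  (exists a x x' y,
    z = << (a *: x + x', y) >> - a *: << (x, y) >> - << (x', y) >>) \/
  (exists a x y y',
    z = << (x, a *: y + y') >> - a *: << (x, y) >> - << (x, y') >>)].

Definition tensor : Type := quotmod (gen_submod tensor_rel).

HB.instance Definition _ := GRing.Lmodule.on tensor.

Definition tens (x : M) (y : N) : tensor :=
  quotproj (gen_submod tensor_rel) << (x, y) >>.


Fact tens_linearl a x x' y : tens (a *: x + x') y = a *: tens x y + tens x' y.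
Proof.
apply/eqP; rewrite -subr_eq0 opprD addrA -linearZ -!raddfB /=.
rewrite pi_quotmod_eq0; apply/asboolP => U; apply.
by left; exists a, x, x', y.
Qed.

Fact tens_linearr a x y y' : tens x (a *: y + y') = a *: tens x y + tens x y'.
Proof.
apply/eqP; rewrite -subr_eq0 opprD addrA -linearZ -!raddfB /=.
rewrite pi_quotmod_eq0; apply/asboolP => U; apply.
by right; exists a, x, y, y'.
Qed.

End Tensor.

Section TensorMap.
Variables (M M' N : lmodType R) (f : {linear M -> M'}).

Definition tensor_map_pre : {linear {freeg (M * N)%type / R} -> tensor M' N} :=
  fglift (fun p => tens (f p.1) p.2).

Fact tensor_map_pre0 z :
  z \in gen_submod (@tensor_rel M N) -> tensor_map_pre z = 0.
Proof.
move=> /asboolP/(_ (ker_submod tensor_map_pre)) h; apply/eqP; apply: h => w.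
move=> [[a [x [x' [y ->]]]]|[a [x [y [y' ->]]]]]; apply/eqP.
  rewrite !linearB linearZ /= /tensor_map_pre /= !liftU !scale1r /=.
  by rewrite linearP tens_linearl addrAC addrK subrr.
rewrite !linearB linearZ /= /tensor_map_pre /= !liftU !scale1r /=.
by rewrite tens_linearr addrAC addrK subrr.
Qed.

Definition tensor_map (z : tensor M N) : tensor M' N :=
  tensor_map_pre (repr z).

Lemma tensor_map_pi (z : {freeg (M * N)%type / R}) :
  tensor_map (quotproj _ z) = tensor_map_pre z.
Proof.
apply/eqP; rewrite -subr_eq0 -raddfB; apply/eqP/tensor_map_pre0.
by rewrite -pi_quotmod_eq0 raddfB /= reprK subrr.
Qed.

Fact tensor_map_linear : linear tensor_map.
Proof.
move=> a; elim/quotW=> x; elim/quotW=> y.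
have -> : a *: \pi_(tensor M N)%qT x + \pi_(tensor M N)%qT y =
    quotproj (gen_submod (@tensor_rel M N)) (a *: x + y) by rewrite linearP.
by rewrite -!/(quotproj _ _) !tensor_map_pi linearP.
Qed.

HB.instance Definition _ := GRing.isLinear.Build R (tensor M N) (tensor M' N)
  *:%R tensor_map tensor_map_linear.

Lemma tensor_map_tens x y : tensor_map (tens x y) = tens (f x) y.
Proof. by rewrite tensor_map_pi /tensor_map_pre /= liftU scale1r. Qed.

End TensorMap.

Arguments tensor_map {M M'} N f.

Section Tor.
Variables M N : lmodType R.

(* The canonical free resolution of M: the first term is the free module on
   the set M, mapping onto M by << x >> |-> x, and one iterates with the
   kernel of that map. *)
Definition free_cover (V : lmodType R) : {linear {freeg V / R} -> V} :=
  fglift id.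

Fixpoint syzygy (i : nat) : lmodType R :=
  if i is j.+1 then submod (ker_submod (free_cover (syzygy j))) else M.

Definition free_res (i : nat) : lmodType R := {freeg (syzygy i) / R}.

Definition free_res_d (i : nat) : {linear free_res i.+1 -> free_res i} :=
  val \o free_cover (syzygy i.+1).

Lemma free_cover_surj (V : lmodType R) (x : V) : free_cover V << x >> = x.
Proof. by rewrite /free_cover /= liftU scale1r. Qed.

Lemma free_res_exact0 x :
  free_cover M x = 0 <-> exists y, free_res_d 0 y = x.
Proof.
split=> [/eqP x0 | [y <-]].
  pose z : syzygy 1 := exist _ x x0; exists << z >>.
  by rewrite /free_res_d /= liftU scale1r.
by apply/eqP; exact: (valP (free_cover (syzygy 1) y)).
Qed.

Lemma free_res_exact i x :
  free_res_d i x = 0 <-> exists y, free_res_d i.+1 y = x.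
Proof.
split=> [x0 | [y <-]].
  have {}x0 : free_cover (syzygy i.+1) x == 0 by apply/eqP/val_inj.
  pose z : syzygy i.+2 := exist _ x x0; exists << z >>.
  by rewrite /free_res_d /= liftU scale1r.
have /eqP y0 := valP (free_cover (syzygy i.+2) y).
exact: (congr1 val y0).
Qed.

Definition Tor (i : nat) : lmodType R :=
  homology (fun j => tensor_map N (free_res_d j)) i.

End Tor.
End Modules.

(* The type does not mention f, but the K-module structure on it does. *)
Definition restr_scalars (K R : nzRingType) (f : {rmorphism K -> R})
  (V : lmodType R) : Type := V.

Section Restriction.
Variables (K R : nzRingType) (f : {rmorphism K -> R}) (V : lmodType R).

HB.instance Definition _ := GRing.Zmodule.on (restr_scalars f V).

Definition restr_scale (c : K) (v : restr_scalars f V) : restr_scalars f V :=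
  f c *: (v : V).

Fact restr_scaleA a b v :
  restr_scale a (restr_scale b v) = restr_scale (a * b) v.
Proof. by rewrite /restr_scale scalerA rmorphM. Qed.

Fact restr_scale1 : left_id 1 restr_scale.
Proof. by move=> v; rewrite /restr_scale rmorph1 scale1r. Qed.

Fact restr_scaleDr : right_distributive restr_scale +%R.
Proof. by move=> a u v; rewrite /restr_scale scalerDr. Qed.

Fact restr_scaleDl v : {morph restr_scale^~ v : a b / a + b}.
Proof. by move=> a b; rewrite /restr_scale rmorphD scalerDl. Qed.

HB.instance Definition _ := GRing.Zmodule_isLmodule.Build K
  (restr_scalars f V)
  restr_scaleA restr_scale1 restr_scaleDr restr_scaleDl.

End Restriction.

(* B is a basis of V when the linear map from the free module on B to V is an
   isomorphism. *)
Definition is_basis (K : fieldType) (V : lmodType K) (B : set V) : Prop :=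
  bijective (fglift (fun x : B => \val x) : {freeg B / K} -> V).

Definition dim_ge (K : fieldType) (V : lmodType K) (k : nat) : Prop :=
  exists2 B : set V, is_basis B & (`I_k #<= B)%card.

Section GradedModules.
Variables (K : fieldType) (n : nat).
Local Notation S := {mpoly K[n]}.

(* The component of S of degree a, spanned by the monomials of degree a: it is
   zero unless a has nonnegative entries. *)
Definition mpoly_comp (a : 'rV[int]_n) : set S :=
  [set s | forall m : 'X_{1..n}, m \in msupp s -> \row_i (m i)%:Z = a].

Record grmod := GrMod {
  grmod_sort :> lmodType S;
  grcomp : 'rV[int]_n -> set grmod_sort;
  grcomp_zmod : forall a, grcomp a 0 /\
    (forall x y, grcomp a x -> grcomp a y -> grcomp a (x - y));
  grcomp_scale : forall a b s x,
    mpoly_comp a s -> grcomp b x -> grcomp (a + b) (s *: x);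
  grcomp_gen : forall x : grmod_sort,
    exists (A : seq 'rV[int]_n) (f : 'rV[int]_n -> grmod_sort),
      (forall a, grcomp a (f a)) /\ x = \sum_(a <- A) f a;
  grcomp_direct : forall (A : seq 'rV[int]_n) (f : 'rV[int]_n -> grmod_sort),
    uniq A -> (forall a, grcomp a (f a)) -> \sum_(a <- A) f a = 0 ->
    forall a, a \in A -> f a = 0
}.

Definition bounded_below (M : grmod) : Prop :=
  exists c : int, forall a : 'rV[int]_n,
    \sum_i a ord0 i <= c -> grcomp (g := M) a = [set 0].

Definition dimK_ge (V : lmodType S) (k : nat) : Prop :=
  dim_ge (restr_scalars (@mpolyC n K) V) k.

End GradedModules.

(* Main.v *)
From HB Require Import structures.
Require Import Defs.
From mathcomp Require Import all_boot all_order all_algebra.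
From mathcomp Require Import boolp classical_sets functions cardinality.
From mathcomp Require Import freeg mpoly.
From mathcomp Require Import zify.

(**
Over the field K, Tor_i(M, N) is the i-th homology of the Koszul complex of
z_k = x_k (x) 1 - 1 (x) x_k on the K-tensor product W = M (x)_K N. Indeed both
sides satisfy dimension shifting along the free covers of the syzygies of M
(exact sequences of K-spaces split, and the Koszul complex of a free module is
acyclic), and they agree in degree 0. As W is Z^n-graded and bounded below, with
z_k of degree e_k, this reduces Tor(M, N) to the Koszul homology of one graded
module.

For a set E of variables let h(i, E, a) mean that the degree-a part of the i-th
Koszul homology of W with respect to E is nonzero. The mapping cone of one
variable k outside E gives
  h(i, E + k, a) => h(i, E, a) or h(i - 1, E, a - e_k),
  h(i, E, a) => h(i, E, a - e_k) or h(i, E + k, a),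
and h(i, E, a) forces i <= |E| and bounds |a| below. From these facts alone,
adding the variables one at a time and using Pascal's rule, h(p, all, a) implies
that h(i, all, b) holds for at least binom(p, i) distinct degrees b; nonzero
classes in distinct degrees are linearly independent.
*)

Set Implicit Arguments.
Unset Strict Implicit.
Unset Printing Implicit Defensive.

Import Order.TTheory GRing.Theory Num.Theory.
Local Open Scope ring_scope.

(** * Bases of vector spaces *)

Section Bases.
Variable K : fieldType.

(** The resolution that defines Tor is free on the underlying sets of the syzygies and carries no
    evident grading, so Tor shows no Z^n-degrees in which to count; W does. The operators z_k are
    chosen because their Koszul complex over S (x)_K S resolves S, and W tensored with S over S
    (x)_K S is M (x)_S N. No isomorphism between Tor and Koszul homology is built. Two one-way
    transfers suffice: nonvanishing passes from Tor_p to Koszul homology, and a family of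
    independent classes passes from Koszul homology to Tor_i. Both use the connecting map from
    H_(i+1) of a module to H_i of its syzygy, once through its injectivity and once through its
    image. Boundedness stops a descent: a class in degree a that dies when the variable k is
    adjoined is replaced by one in degree a - e_k, and this cannot go on forever. *)

Definition free_set (V : lmodType K) (B : set V) : Prop :=
  forall (s : seq V) (c : V -> K), uniq s -> (forall v, v \in s -> B v) ->
  \sum_(v <- s) c v *: v = 0 -> forall v, v \in s -> c v = 0.

Definition spanned (V : lmodType K) (B : set V) (x : V) : Prop :=
  exists (s : seq V) (c : V -> K),
    [/\ uniq s, forall v, v \in s -> B v & x = \sum_(v <- s) c v *: v].

(** A linear relation involves finitely many vectors, and these all lie in one member of the
    chain. *)
Lemma free_set_bigcup (V : lmodType K) (F : set (set V)) :
  (F `<=` @free_set V)%classic -> total_on F subset ->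
  free_set (\bigcup_(X in F) X)%classic.
Proof.
move=> Ffree Ftot s c us sF.
have [->|[X FX sX]] : s = [::] \/ exists2 X, F X & forall v, v \in s -> X v.
  elim: s sF {us} => [|v s IHs] sF; [by left | right].
  have [Y FY Yv] := sF v (mem_head v s).
  have [->|[X FX sX]] := IHs (fun w ws => sF w (@mem_behead _ (v :: s) w ws)).
    by exists Y => // w; rewrite inE => /eqP->.
  by have [XY|YX] := Ftot _ _ FX FY; [exists Y|exists X] => // w;
     rewrite inE => /predU1P[->|ws] //; [apply/XY/sX|apply: YX|apply: sX].
  by move=> _ v; rewrite in_nil.
exact: (Ffree _ FX s c us sX).
Qed.

Lemma free_set_extend (V : lmodType K) (A : set V) : free_set A ->
  exists B : set V, [/\ (A `<=` B)%classic, free_set B & forall x, spanned B x].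
Proof.
move=> Afree.
(* Zorn is run on the sets added to [A] rather than on the free sets containing [A], so that the
   empty chain is harmless: its union is empty, and [A] itself is free. *)
pose P (C : set V) := free_set (A `|` C)%classic.
have Pchain (F : set (set V)) : (F `<=` P)%classic -> total_on F subset ->
    P (\bigcup_(X in F) X)%classic.
  move=> FP Ftot; have [[X0 FX0]|F0] := pselect (exists X, F X); last first.
    rewrite /P; suff -> : (\bigcup_(X in F) X)%classic = set0 by rewrite setU0.
    by apply/seteqP; split=> // x [X FX]; case: F0; exists X.
  rewrite /P (_ : (A `|` _)%classic =
      (\bigcup_(X in [set (A `|` Y)%classic | Y in F]%classic) X)%classic).
    apply: free_set_bigcup => [_ [Y FY <-]|_ _ [Y FY <-] [Z FZ <-]].
      exact: FP.
    by have [YZ|ZY] := Ftot _ _ FY FZ; [left|right]; apply: setUS.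
  apply/seteqP; split=> [x [Ax|[X FX Xx]]|x [_ [Y FY <-]] [Ax|Yx]].
  - by exists (A `|` X0)%classic; [exists X0|left].
  - by exists (A `|` X)%classic; [exists X|right].
  - by left.
  - by right; exists Y.
have [C [PC Cmax]] := Zorn_bigcup Pchain.
set B := (A `|` C)%classic in PC; exists B; split=> // [x Ax|x]; first by left.
have [Bx|nBx] := pselect (B x).
  exists [:: x], (fun=> 1); split=> // [v|]; first by rewrite inE => /eqP->.
  by rewrite big_seq1 scale1r.
have /Cmax nP : (C `<` x |` C)%classic.
  split=> [y Cy|]; first by right.
  by move=> sub; apply: nBx; right; apply: sub; left.
apply: contrapT => nspan; apply: nP => s c us sB s0.
have sB' v : v \in rem x s -> B v.
  rewrite mem_rem_uniq // inE /= => /andP[vx /sB[|[]]]; [by left| |by right].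
  by move=> /= vx'; rewrite vx' eqxx in vx.
have urem := rem_uniq x us.
have [xs|xs] := boolP (x \in s); last first.
  by apply: PC s0 => // v vs; apply: sB'; rewrite rem_id.
move: s0; rewrite (big_rem x) //= => s0.
have cx0 : c x = 0.
  apply/eqP; apply: contrapT => /negP cx; apply: nspan.
  exists (rem x s), (fun v => - (c x)^-1 * c v); split=> //.
  under eq_bigr do rewrite -scalerA.
  rewrite -scaler_sumr; move: s0 => /eqP; rewrite addr_eq0 => /eqP s0.
  by rewrite -[X in - _ *: X]opprK -s0 scalerN scaleNr opprK scalerA mulVf // scale1r.
move: s0; rewrite cx0 scale0r add0r => s0 v vs.
have [->//|vx] := eqVneq v x.
by apply: (PC (rem x s)) => //; rewrite mem_rem_uniq // inE vx.
Qed.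

Lemma basis_of_free_spanned (V : lmodType K) (B : set V) :
  free_set B -> (forall x, spanned B x) -> is_basis B.
Proof.
move=> Bfree Bspan.
pose g : {linear {freeg B / K} -> V} := fglift (fun x : B => \val x).
have gE D : g D = \sum_(b <- dom D) coeff b D *: \val b.
  rewrite -[in LHS](freeg_sumE D) raddf_sum.
  by apply: eq_bigr => b _; rewrite /g /= liftU.
have gi : injective g.
  apply: raddf_inj => D gD0; apply/eqP/freeg_eqP => b; rewrite coeff0.
  have [bD|/coeff_outdom//] := boolP (b \in dom D).
  pose c v := if insub v is Some b then coeff b D else 0.
  have cval b' : c (\val b') = coeff b' D by rewrite /c valK.
  rewrite -cval; apply: (Bfree [seq \val b | b <- dom D]).
  - by rewrite map_inj_uniq ?uniq_dom //; apply: val_inj.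
  - by move=> _ /mapP[b' _ ->]; apply/set_mem/valP.
  - by rewrite big_map -[RHS](gD0 : g D = 0) gE; apply: eq_bigr => b' _; rewrite cval.
  - exact: map_f.
have gs x : exists D, g D == x.
  have [s [c [us sB ->]]] := Bspan x.
  suff [D gD] : exists D, g D = \sum_(v <- s) c v *: v by exists D; apply/eqP.
  elim: s sB {us} => [|v s IHs] sB.
    by exists 0; rewrite big_nil linear0.
  have [D gD] := IHs (fun w ws => sB w (@mem_behead _ (v :: s) w ws)).
  exists (<< c v *g (SigSub (mem_set (sB v (mem_head v s))) : B) >> + D).
  by rewrite linearD gD big_cons /g /= liftU.
exists (fun x => xchoose (gs x)) => x; last exact/eqP/(xchooseP (gs x)).
by apply: gi; apply/eqP/(xchooseP (gs (g x))).
Qed.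

Lemma dim_ge_free (V : lmodType K) (k : nat) (v : 'I_k -> V) :
  (forall c : 'I_k -> K, \sum_t c t *: v t = 0 -> forall t, c t = 0) ->
  dim_ge V k.
Proof.
move=> vfree.
have vi : injective v.
  move=> t u vtu; apply/eqP; apply: contrapT => /negP tu.
  (* Two equal vectors at distinct indices would give a relation with coefficient 1 at [t] and -1 at
     [u]. *)
  have := vfree (fun w => (w == t)%:R - (w == u)%:R).
  under eq_bigr do rewrite scalerBl.
  rewrite sumrB (bigD1 t) //= [X in _ - X](bigD1 u) //= !eqxx !big1.
  - rewrite !addr0 vtu !scale1r subrr => /(_ erefl t).
    by rewrite eqxx (negbTE tu) subr0 => /eqP; rewrite oner_eq0.
  - by move=> w /negbTE->; rewrite scale0r.
  - by move=> w /negbTE->; rewrite scale0r.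
have vA : free_set (range v).
  move=> s c us sv s0.
  have cv : \sum_t (if v t \in s then c (v t) else 0) *: v t = 0.
    rewrite -[RHS]s0.
    rewrite (eq_bigr (fun t => if v t \in s then c (v t) *: v t else 0)); last first.
      by move=> t _; case: ifP => _; rewrite ?scale0r.
    have -> : \sum_t (if v t \in s then c (v t) *: v t else 0) =
        \sum_(w <- [seq v t | t <- enum 'I_k]) (if w \in s then c w *: w else 0).
      by rewrite big_map big_enum.
    rewrite -big_mkcond -big_filter; apply: perm_big; apply: uniq_perm => //.
      by rewrite filter_uniq // map_inj_uniq ?enum_uniq.
    move=> w; rewrite mem_filter; case: (boolP (w \in s)) => //= /sv[t _ <-].
    by rewrite map_f ?mem_enum.
  move=> w ws; have [t _ vt] := sv w ws.
  by have := vfree _ cv t; rewrite vt ws.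
have [B [AB Bfree Bspan]] := free_set_extend vA.
exists B; first exact: basis_of_free_spanned.
have: (range v #<= B)%card by apply: subset_card_le.
apply: card_le_trans.
(* [g] recovers the index of a vector of the family, hence maps the range of [v] onto [I_k]; the
   default 0 only serves other vectors. *)
pose g (w : V) : nat := if [pick t | v t == w] is Some t then t else 0%N.
apply: card_le_trans (card_image_le g _); apply: subset_card_le => i /= ik.
exists (v (Ordinal ik)); first by exists (Ordinal ik).
by rewrite /g; case: pickP => [t /eqP/vi->|/(_ (Ordinal ik))] //; rewrite eqxx.
Qed.

(** A basis of U is carried to a free set, which extends to a basis of V; the retraction undoes [f]
    on the former and kills the added vectors, through the default 0 of [xget]. *)
Lemma linear_retraction (U V : lmodType K) (f : {linear U -> V}) :
  injective f -> exists r : {linear V -> U}, cancel f r.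
Proof.
move=> fi.
have free0 : free_set (set0 : set U).
  by move=> s c _ s0 _ v /s0.
have [A [_ Afree Aspan]] := free_set_extend free0.
have fA : free_set (f @` A)%classic.
  move=> s c us sA s0.
  have s'E : [seq f u | u <- [seq xget 0 [set u | A u /\ f u = v]%classic | v <- s]] = s.
    rewrite -map_comp -[RHS]map_id; apply/eq_in_map => v /sA[u Au fu] /=.
    by case: xgetP => [_ -> []//|/(_ u)[]].
  set s' := map _ s in s'E.
  move: s0; rewrite -s'E big_map => s0 v.
  move=> /mapP[u us' ->].
  apply: (Afree s' (c \o f)) us' => //.
  - by rewrite -(map_inj_uniq fi) s'E.
  - move=> w /mapP[v' /sA[w' Aw' fw'] ->].
    by case: xgetP => [_ -> []//|/(_ w')[]].
  - apply: fi; rewrite raddf0 raddf_sum -[RHS]s0.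
    by apply: eq_bigr => w _; exact: linearZ.
have [B [AB Bfree Bspan]] := free_set_extend fA.
have [g gK Kg] := basis_of_free_spanned Bfree Bspan.
pose h : {linear {freeg B / K} -> V} := fglift (fun x : B => \val x).
have glin : linear g.
  move=> a x y; rewrite -[in LHS](Kg x) -[in LHS](Kg y).
  by rewrite -[fglift _]/(h : _ -> _) -linearP gK.
pose r0 (b : B) := xget 0 [set u | A u /\ f u = \val b]%classic.
pose h0 : {linear {freeg B / K} -> U} := fglift r0.
have rlin : linear (h0 \o g) by move=> a x y /=; rewrite glin linearP.
pose r : {linear V -> U} := HB.pack_for {linear V -> U} (h0 \o g)
  (GRing.isLinear.Build K V U *:%R _ rlin).
exists r => u; have [s [c [_ sA ->]]] := Aspan u.
rewrite !linear_sum; apply: eq_big_seq => w ws; rewrite !linearZ; congr (_ *: _).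
have Aw := sA w ws.
have Bw : B (f w) by apply: AB; exists w.
have -> : f w = h << (SigSub (mem_set Bw) : B) >> by rewrite /h /= liftU scale1r.
rewrite /r /= gK /h0 /= liftU scale1r /r0 /=.
by case: xgetP => [_ -> [_ /fi]//|/(_ w)[]].
Qed.

End Bases.

(** * Tensor products and restriction of scalars *)

Section TensorTheory.
Variable R : comNzRingType.

Section Bilinear.
Variables M N : lmodType R.
Implicit Types (x : M) (y : N) (z : tensor M N).

Lemma tensDl x x' y : tens (x + x') y = tens x y + tens x' y.
Proof. by have := tens_linearl 1 x x' y; rewrite !scale1r. Qed.

Lemma tensDr x y y' : tens x (y + y') = tens x y + tens x y'.
Proof. by have := tens_linearr 1 x y y'; rewrite !scale1r. Qed.

Lemma tens0l y : tens (0 : M) y = 0.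
Proof. by apply: (addrI (tens 0 y)); rewrite -tensDl !addr0. Qed.

Lemma tens0r x : tens x (0 : N) = 0.
Proof. by apply: (addrI (tens x 0)); rewrite -tensDr !addr0. Qed.

Lemma tensZl a x y : tens (a *: x) y = a *: tens x y.
Proof. by have := tens_linearl a x 0 y; rewrite tens0l !addr0. Qed.

Lemma tensZr a x y : tens x (a *: y) = a *: tens x y.
Proof. by have := tens_linearr a x y 0; rewrite tens0r !addr0. Qed.

(** Scalars are absorbed into the left factor, so sums of pure tensors without coefficients
    suffice. *)
Lemma tensor_ind (P : tensor M N -> Prop) :
  P 0 -> (forall x y z, P z -> P (tens x y + z)) -> forall z, P z.
Proof.
move=> P0 PD; elim/quotW=> D; rewrite -/(quotproj _ D).
rewrite -(freeg_sumE D) linear_sum /=.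
elim: (dom D) => [|[x y] s IHs]; first by rewrite big_nil.
rewrite big_cons; set c := coeff _ _.
suff -> : quotproj (gen_submod (@tensor_rel _ M N)) << c *g (x, y) >> =
    tens (c *: x) y by exact: PD.
rewrite tensZl /tens -linearZ; congr quotproj.
by apply/eqP/freeg_eqP => p; rewrite coeffZ !coeffU mul1r.
Qed.

(** The universal property of the tensor product: the kernel of the induced map on the free module
    is a submodule containing the defining relations, hence the one they generate. *)
Lemma tensor_lift_ex (V : lmodType R) (phi : M -> N -> V) :
  (forall a x x' y, phi (a *: x + x') y = a *: phi x y + phi x' y) ->
  (forall a x y y', phi x (a *: y + y') = a *: phi x y + phi x y') ->
  exists h : {linear tensor M N -> V}, forall x y, h (tens x y) = phi x y.
Proof.
move=> phil phir.
pose h0 : {linear {freeg (M * N)%type / R} -> V} :=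
  fglift (fun p => phi p.1 p.2).
have h0_rel w : w \in gen_submod (@tensor_rel R M N) -> h0 w = 0.
  move=> /asboolP/(_ (ker_submod h0)) sub; apply/eqP; apply: sub => v.
  move=> [[a [x [x' [y ->]]]]|[a [x [y [y' ->]]]]]; apply/eqP.
    by rewrite !linearB linearZ /h0 /= !liftU !scale1r /= phil addrAC addrK subrr.
  by rewrite !linearB linearZ /h0 /= !liftU !scale1r /= phir addrAC addrK subrr.
pose h1 (z : tensor M N) := h0 (repr z).
have h1E w : h1 (quotproj _ w) = h0 w.
  apply/eqP; rewrite -subr_eq0 -linearB; apply/eqP/h0_rel.
  by rewrite -pi_quotmod_eq0 raddfB /= reprK subrr.
have h1_lin : linear h1.
  move=> a; elim/quotW=> x; elim/quotW=> y.
  have -> : a *: \pi_(tensor M N)%qT x + \pi_(tensor M N)%qT y =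
    quotproj (gen_submod (@tensor_rel R M N)) (a *: x + y) by rewrite linearP.
  by rewrite -!/(quotproj _ _) !h1E linearP.
exists (HB.pack_for {linear tensor M N -> V} h1
  (GRing.isLinear.Build R (tensor M N) V *:%R _ h1_lin)) => x y /=.
by rewrite /tens h1E /h0 /= liftU scale1r.
Qed.

End Bilinear.

Lemma tensor_map0 (M M' N : lmodType R) (f : {linear M -> M'}) :
  tensor_map f (0 : tensor M N) = 0.
Proof. exact: raddf0. Qed.

Lemma tensor_mapD (M M' N : lmodType R) (f : {linear M -> M'}) (u v : tensor M N) :
  tensor_map f (u + v) = tensor_map f u + tensor_map f v.
Proof. exact: raddfD. Qed.

Section TensorMap2.
Variables (M M' N N' : lmodType R).
Variables (f : {linear M -> M'}) (g : {linear N -> N'}).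

Fact tmap_ex :
  exists h : {linear tensor M N -> tensor M' N'},
    forall x y, h (tens x y) = tens (f x) (g y).
Proof.
apply: tensor_lift_ex => [a x x' y|a x y y'].
  by rewrite linearP tens_linearl.
by rewrite linearP tens_linearr.
Qed.

Definition tmap : {linear tensor M N -> tensor M' N'} := sval (cid tmap_ex).

Lemma tmapE x y : tmap (tens x y) = tens (f x) (g y).
Proof. exact: (svalP (cid tmap_ex)). Qed.

Lemma tmap0 : tmap 0 = 0.
Proof. exact: raddf0. Qed.

Lemma tmapD u v : tmap (u + v) = tmap u + tmap v.
Proof. exact: raddfD. Qed.

End TensorMap2.

(** Functoriality in both factors, with compositions given pointwise so that only the underlying
    functions have to agree. *)
Lemma tmap_square (M M1 M2 M' N N1 N2 N' : lmodType R)
    (f1 : {linear M -> M1}) (f1' : {linear M1 -> M'})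
    (f2 : {linear M -> M2}) (f2' : {linear M2 -> M'})
    (g1 : {linear N -> N1}) (g1' : {linear N1 -> N'})
    (g2 : {linear N -> N2}) (g2' : {linear N2 -> N'}) :
  (forall x, f1' (f1 x) = f2' (f2 x)) -> (forall y, g1' (g1 y) = g2' (g2 y)) ->
  forall w, tmap f1' g1' (tmap f1 g1 w) = tmap f2' g2' (tmap f2 g2 w).
Proof.
move=> fE gE; elim/tensor_ind => [|x y w IHw]; first by rewrite !linear0.
by rewrite !linearD IHw !tmapE fE gE.
Qed.

Lemma tmap_triangle (M M1 M' N N1 N' : lmodType R)
    (f1 : {linear M -> M1}) (f1' : {linear M1 -> M'}) (f2 : {linear M -> M'})
    (g1 : {linear N -> N1}) (g1' : {linear N1 -> N'}) (g2 : {linear N -> N'}) :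
  (forall x, f1' (f1 x) = f2 x) -> (forall y, g1' (g1 y) = g2 y) ->
  forall w, tmap f1' g1' (tmap f1 g1 w) = tmap f2 g2 w.
Proof.
move=> fE gE; elim/tensor_ind => [|x y w IHw]; first by rewrite !linear0.
by rewrite !linearD IHw !tmapE fE gE.
Qed.

Lemma tmap_id (M N : lmodType R) (f : {linear M -> M}) (g : {linear N -> N}) :
  (forall x, f x = x) -> (forall y, g y = y) -> forall w, tmap f g w = w.
Proof.
move=> fE gE; elim/tensor_ind => [|x y w IHw]; first by rewrite !linear0.
by rewrite !linearD IHw !tmapE fE gE.
Qed.

Lemma tmapDl (M M' N N' : lmodType R) (f f1 f2 : {linear M -> M'})
    (g : {linear N -> N'}) :
  (forall x, f x = f1 x + f2 x) -> forall w, tmap f g w = tmap f1 g w + tmap f2 g w.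
Proof.
move=> fE; elim/tensor_ind => [|x y w IHw]; first by rewrite !linear0 addr0.
by rewrite !linearD IHw !tmapE fE tensDl addrACA.
Qed.
End TensorTheory.

Section RestrictionOfScalars.
Variables (K R : comNzRingType) (phi : {rmorphism K -> R}).
Local Notation "M '_K'" := (restr_scalars phi M : lmodType K)
  (at level 2, format "M '_K'").

Fact restr_linear (M M' : lmodType R) (f : {linear M -> M'}) :
  linear (f : M _K -> M' _K).
Proof. by move=> a x y; rewrite -[LHS]/(f (phi a *: (x : M) + y)) linearP. Qed.

Definition restr_lin (M M' : lmodType R) (f : {linear M -> M'}) :
    {linear M _K -> M' _K} :=
  HB.pack_for {linear M _K -> M' _K} (f : M _K -> M' _K)
    (GRing.isLinear.Build K (M _K) (M' _K) *:%R _ (restr_linear f)).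

Lemma restr_linE (M M' : lmodType R) (f : {linear M -> M'}) (x : M) :
  restr_lin f x = f x.
Proof. by []. Qed.

End RestrictionOfScalars.

(** * Koszul complexes *)

Section Exterior.
Variables (K : fieldType) (n : nat).
Implicit Types (k l : 'I_n) (A E : {set 'I_n}).

(** The sign that sorts e_k /\ e_A into increasing order. *)
Definition ext_sign k A : K := (-1) ^+ #|[set l in A | (l < k)%N]|.

Lemma ext_signK k A : ext_sign k A * ext_sign k A = 1.
Proof. by rewrite -expr2 sqrr_sign. Qed.

Lemma ext_signU k l A : l \notin A ->
  ext_sign k (l |: A) = (-1) ^+ (l < k)%N * ext_sign k A.
Proof.
move=> lA; rewrite -exprD; congr (_ ^+ _).
have [lk|lk] := boolP (l < k)%N.
  rewrite (_ : [set _ in _ | _] = l |: [set m in A | (m < k)%N]).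
    by rewrite cardsU1 inE (negbTE lA).
  by apply/setP => m; rewrite !inE; case: eqP => // ->; rewrite lk.
rewrite add0n; congr #|pred_of_set _|; apply/setP => m; rewrite !inE.
by case: eqP => // ->; rewrite (negbTE lk) !andbF.
Qed.

(** Exactly one of [l < k] and [k < l] holds, so exchanging the order of insertion changes exactly
    one sign. *)
Lemma ext_signC k l A : k != l -> k \notin A -> l \notin A ->
  ext_sign k A * ext_sign l (k |: A) = - (ext_sign l A * ext_sign k (l |: A)).
Proof.
move=> kl kA lA; rewrite !ext_signU // mulrCA [X in _ = - X]mulrCA.
rewrite [ext_sign l A * _]mulrC -mulNr; congr (_ * _).
have := kl; rewrite -val_eqE /=.
by case: ltngtP => // _ _; rewrite ?expr0 ?expr1 ?opprK.
Qed.

Section Operators.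
Variable W : lmodType K.
Local Notation Omega := {ffun {set 'I_n} -> W}.
Implicit Types f g : Omega.

(** An element of [Omega] stands for the sum of the f A (x) e_A in the exterior algebra on e_1, ...,
    e_n with coefficients in W. Here [contr k] is contraction with the k-th dual basis vector and
    [wedge k] is left multiplication by e_k. *)
Definition contr k f : Omega :=
  [ffun A : {set 'I_n} => if k \in A then 0 else ext_sign k A *: f (k |: A)].

Definition wedge k f : Omega :=
  [ffun A : {set 'I_n} => if k \in A then ext_sign k (A :\ k) *: f (A :\ k) else 0].

Fact contr_linear k : linear (contr k).
Proof.
move=> a f g; apply/ffunP => A; rewrite !ffunE.
case: ifP => _; first by rewrite scaler0 addr0.
by rewrite scalerDr !scalerA mulrC.
Qed.

HB.instance Definition _ k :=
  GRing.isLinear.Build K Omega Omega *:%R (contr k) (contr_linear k).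

Fact wedge_linear k : linear (wedge k).
Proof.
move=> a f g; apply/ffunP => A; rewrite !ffunE.
case: ifP => _; last by rewrite scaler0 addr0.
by rewrite scalerDr !scalerA mulrC.
Qed.

HB.instance Definition _ k :=
  GRing.isLinear.Build K Omega Omega *:%R (wedge k) (wedge_linear k).

Lemma contr_contr k f : contr k (contr k f) = 0.
Proof.
by apply/ffunP => A; rewrite !ffunE setU11 scaler0; case: ifP.
Qed.

Lemma contrC k l f : k != l -> contr k (contr l f) = - contr l (contr k f).
Proof.
move=> kl; apply/ffunP => A; rewrite !ffunE !inE (negbTE kl) eq_sym (negbTE kl) /=.
case: ifPn => kA; case: ifPn => lA; rewrite ?scaler0 ?oppr0 //.
by rewrite !scalerA ext_signC // scaleNr finset.setUCA.
Qed.

Lemma contr_wedgeC k l f : k != l -> contr k (wedge l f) = - wedge l (contr k f).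
Proof.
move=> kl; apply/ffunP => A; rewrite !ffunE !inE (negbTE kl) eq_sym (negbTE kl) /=.
case: ifPn => kA; case: ifPn => lA; rewrite ?scaler0 ?oppr0 //.
have E1 : (k |: A) :\ l = k |: A :\ l.
  by apply/setP => m; rewrite !inE; case: eqP => // ->; rewrite eq_sym (negbTE kl).
rewrite E1 !scalerA -scaleNr; congr (_ *: _).
have kAl : k \notin A :\ l by rewrite !inE negb_and kA orbT.
have lAl : l \notin A :\ l by rewrite !inE eqxx.
have := ext_signC kl kAl lAl; rewrite (finset.setD1K lA) => sC.
rewrite -[LHS]mul1r -(ext_signK k (A :\ l)) mulrACA sC mulrN mulrACA.
by rewrite ext_signK mulr1 mulrC.
Qed.

(** The relation iota_k e_k + e_k iota_k = 1, on an element that does not involve e_k. *)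
Lemma contr_wedge k f : contr k f = 0 -> contr k (wedge k f) = f.
Proof.
move=> kf; apply/ffunP => A; rewrite !ffunE; case: ifPn => kA.
  move/ffunP/(_ (A :\ k)): kf; rewrite !ffunE !inE eqxx /= finset.setD1K //.
  move=> /(congr1 ( *:%R (ext_sign k (A :\ k)))).
  by rewrite scalerA ext_signK scale1r scaler0.
by rewrite setU11 finset.setU1K // scalerA ext_signK scale1r.
Qed.

Definition ext_homog (i : nat) f : Prop := forall A, #|A| != i -> f A = 0.

Lemma ext_homogD i f g : ext_homog i f -> ext_homog i g -> ext_homog i (f + g).
Proof. by move=> hf hg A iA; rewrite ffunE hf ?hg ?addr0. Qed.

Lemma ext_homogZ i a f : ext_homog i f -> ext_homog i (a *: f).
Proof. by move=> hf A iA; rewrite ffunE hf ?scaler0. Qed.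

Lemma ext_homogN i f : ext_homog i f -> ext_homog i (- f).
Proof. by move=> hf; rewrite -scaleN1r; apply: ext_homogZ. Qed.

Lemma ext_homogB i f g : ext_homog i f -> ext_homog i g -> ext_homog i (f - g).
Proof. by move=> hf hg; apply: ext_homogD => //; apply: ext_homogN. Qed.

Lemma ext_homog_sum i (I : Type) (r : seq I) (P : pred I) (F : I -> Omega) :
  (forall j, P j -> ext_homog i (F j)) -> ext_homog i (\sum_(j <- r | P j) F j).
Proof.
move=> hF; elim/big_ind: _ => [A _|f g|//]; first by rewrite ffunE.
exact: ext_homogD.
Qed.

Lemma contr_homog i k f : ext_homog i.+1 f -> ext_homog i (contr k f).
Proof.
move=> hf A iA; rewrite ffunE; case: ifPn => // kA.
by rewrite hf ?scaler0 // cardsU1 kA.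
Qed.

Lemma wedge_homog i k f : ext_homog i f -> ext_homog i.+1 (wedge k f).
Proof.
move=> hf A iA; rewrite ffunE; case: ifPn => // kA.
by rewrite hf ?scaler0 //; move: iA; rewrite (cardsD1 k A) kA add1n eqSS.
Qed.

(** A set A of size i contains some l outside E, and [contr l f = 0] read at A minus l gives f A =
    0. *)
Lemma contr_off i E f : ext_homog i f -> (forall l, l \notin E -> contr l f = 0) ->
  (#|E| < i)%N -> f = 0.
Proof.
move=> hf fE Ei; apply/ffunP => A; rewrite ffunE.
have [Ai|/hf//] := eqVneq #|A| i.
have /subsetPn[l lA lE] : ~~ (A \subset E).
  by apply/negP => /subset_leq_card; rewrite Ai leqNgt Ei.
have /ffunP/(_ (A :\ l)) := fE l lE; rewrite !ffunE !inE eqxx /= finset.setD1K //.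
move=> /(congr1 ( *:%R (ext_sign l (A :\ l)))).
by rewrite scalerA ext_signK scale1r scaler0.
Qed.

End Operators.

Section Pointwise.
Variables W W' : lmodType K.
Variable u : {linear W -> W'}.
Implicit Types f : {ffun {set 'I_n} -> W}.

Definition ext_map f : {ffun {set 'I_n} -> W'} := [ffun A => u (f A)].

Fact ext_map_linear : linear ext_map.
Proof. by move=> a f g; apply/ffunP => A; rewrite !ffunE linearP. Qed.

HB.instance Definition _ :=
  GRing.isLinear.Build K _ _ *:%R ext_map ext_map_linear.

Lemma ext_map_contr k f : ext_map (contr k f) = contr k (ext_map f).
Proof.
by apply/ffunP => A; rewrite !ffunE; case: ifP => _; rewrite ?linear0 ?linearZ.
Qed.

Lemma ext_map_wedge k f : ext_map (wedge k f) = wedge k (ext_map f).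
Proof.
by apply/ffunP => A; rewrite !ffunE; case: ifP => _; rewrite ?linear0 ?linearZ.
Qed.

Lemma ext_map_homog i f : ext_homog i f -> ext_homog i (ext_map f).
Proof. by move=> hf A iA; rewrite ffunE hf ?linear0. Qed.

End Pointwise.

Section Koszul.
Variables (W : lmodType K) (z : 'I_n -> {linear W -> W}).
Hypothesis zC : forall k l w, z k (z l w) = z l (z k w).
Local Notation Omega := {ffun {set 'I_n} -> W}.
Implicit Types f g : Omega.

Definition koszul f : Omega := \sum_k ext_map (z k) (contr k f).

Fact koszul_linear : linear koszul.
Proof.
move=> a f g; rewrite /koszul scaler_sumr -big_split.
by apply: eq_bigr => k _; rewrite !linearP.
Qed.

HB.instance Definition _ :=
  GRing.isLinear.Build K Omega Omega *:%R koszul koszul_linear.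

(** Contractions anticommute with each other and leave the coefficients alone. With f = f_0 + e_k /\
    f_1, where f_0 and f_1 avoid e_k, [contr k f] is f_1: the projection of the mapping cone of the
    variable k onto its shifted part. *)
Lemma koszul_contr k f : koszul (contr k f) = - contr k (koszul f).
Proof.
rewrite /koszul linear_sum -sumrN; apply: eq_bigr => l _.
rewrite /= -ext_map_contr -linearN; have [->|kl] := eqVneq k l.
  by rewrite contr_contr oppr0.
by rewrite contrC // eq_sym.
Qed.

Lemma koszul_homog i f : ext_homog i.+1 f -> ext_homog i (koszul f).
Proof.
by move=> hf; apply: ext_homog_sum => k _; apply/ext_map_homog/contr_homog.
Qed.

Lemma koszul_koszul f : koszul (koszul f) = 0.
Proof.
pose a k l := ext_map (z k) (ext_map (z l) (contr k (contr l f))).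
have aN k l : a k l = - a l k.
  have [->|kl] := eqVneq k l.
    by rewrite /a contr_contr !linear0.
  rewrite /a contrC // !linearN; congr (- _).
  by apply/ffunP => A; rewrite !ffunE zC.
(* The diagonal is treated apart, since antisymmetry does not make it vanish in characteristic 2. *)
have akk k : a k k = 0 by rewrite /a contr_contr !linear0.
have -> : koszul (koszul f) = \sum_k \sum_l a k l.
  rewrite {1}/koszul; apply: eq_bigr => k _; rewrite /koszul !linear_sum.
  by apply: eq_bigr => l _; rewrite /a /= -ext_map_contr.
(* The pairs with l < k cancel those with k < l. *)
under eq_bigr => k _ do rewrite (bigID (fun l : 'I_n => (l < k)%N)) /=.
rewrite big_split /= (exchange_big_dep xpredT) //= -big_split big1 //= => k _.
rewrite [X in _ + X](bigD1 k) ?ltnn //= akk add0r.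
under eq_bigr => l _ do rewrite aN.
rewrite sumrN; apply/eqP; rewrite addrC subr_eq0; apply/eqP/eq_bigl => l.
by rewrite -leqNgt ltn_neqAle andbC eq_sym -val_eqE.
Qed.

(* A cycle f is homologous to f' = f - d (G (e_k /\ f)) with iota_k f' = 0, so
   eliminating the variables in turn leaves a cycle of exterior degree 0. *)
Lemma koszul_acyclic :
  (forall k f, exists G : {linear W -> W},
    (forall A, G (z k (f A)) = f A) /\
    (forall l w, l != k -> G (z l w) = z l (G w))) ->
  forall i f, ext_homog i.+1 f -> koszul f = 0 ->
    exists2 g, ext_homog i.+2 g & koszul g = f.
Proof.
move=> zG i f hf df.
suff [g hg gE] : exists2 g, ext_homog i.+2 g &
    forall k, k \in enum 'I_n -> contr k (f - koszul g) = 0.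
  exists g => //; apply/eqP; rewrite eq_sym -subr_eq0; apply/eqP.
  apply: (@contr_off _ i.+1 finset.set0); rewrite ?cards0 //.
    by apply: ext_homogB => //; apply: koszul_homog.
  by move=> l _; apply: gE; rewrite mem_enum.
elim: (enum 'I_n) => [|k s [g hg gE]]; first by exists 0 => // A _; rewrite ffunE.
have [f' f'E] : exists f', f' = f - koszul g by exists (f - koszul g).
rewrite -f'E in gE.
have df' : koszul f' = 0 by rewrite f'E linearB /= df koszul_koszul subrr.
have hf' : ext_homog i.+1 f' by rewrite f'E; apply: ext_homogB => //; apply: koszul_homog.
(* [G] may depend on f': it has to undo z_k only on the finitely many coefficients of f', which a
   locally finite geometric series can do. *)
have [G [Gz GC]] := zG k f'.
pose h := ext_map G (wedge k f').
have dh : koszul h = wedge k (contr k f') +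
    ext_map (z k) (ext_map G (contr k (wedge k f'))).
  rewrite {1}/koszul (bigD1 k) //= addrC; congr (_ + _); last first.
    by rewrite /h -ext_map_contr.
  have -> : wedge k (contr k f') = ext_map G (wedge k (ext_map (z k) (contr k f'))).
    apply/ffunP => A; rewrite !ffunE; case: ifP => _; rewrite ?linear0 //.
    case: ifP => _; rewrite ?linear0 ?scaler0 ?linear0 //.
    by rewrite !linearZ /= Gz.
  (* As f' is a cycle, the terms with l <> k add up to G applied to e_k /\ z_k iota_k f', where G
     cancels z_k. *)
  have := df'; rewrite {1}/koszul (bigD1 k) //= => /eqP.
  rewrite addr_eq0 => /eqP ->; rewrite !linearN linear_sum linear_sum -sumrN /=.
  apply: eq_bigr => l lk; rewrite /h -ext_map_contr contr_wedgeC //.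
  rewrite !linearN; congr (- _); rewrite -ext_map_wedge.
  by apply/ffunP => A; rewrite !ffunE GC.
have hh : ext_homog i.+2 h by apply/ext_map_homog/wedge_homog.
exists (g + h) => [|l]; first exact: ext_homogD.
rewrite [koszul (g + h)]linearD /= opprD addrA -f'E inE; have [-> _|lk /= ls] := eqVneq l k.
  rewrite linearB dh linearD /= contr_wedge ?contr_contr //.
  by rewrite -!ext_map_contr contr_contr !linear0 addr0 subrr.
(* Variables eliminated before stay eliminated: iota_l f' = 0 gives iota_l h = 0, hence iota_l (d h)
   = 0. *)
rewrite linearB /= gE // sub0r -[contr l (koszul h)]opprK -koszul_contr.
by rewrite opprK /h -ext_map_contr contr_wedgeC // gE // !linear0.
Qed.

(** The boundaries of exterior degree 0, read in W instead of [Omega]. *)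
Definition koszul_im (w : W) : Prop := exists u : 'I_n -> W, w = \sum_k z k (u k).

Lemma koszul_im_homog1 f : ext_homog 1 f -> koszul_im (koszul f finset.set0).
Proof.
move=> hf; exists (fun k => contr k f finset.set0).
by rewrite /koszul sum_ffunE; apply: eq_bigr => k _; rewrite ffunE.
Qed.

Lemma ext_homog0_ex (w : W) : exists f, ext_homog 0 f /\ f finset.set0 = w.
Proof.
exists [ffun A : {set 'I_n} => if A == finset.set0 then w else 0].
split; last by rewrite ffunE eqxx.
by move=> A; rewrite cards_eq0 ffunE => /negbTE->.
Qed.

Lemma koszul_im_ex f : ext_homog 0 f -> koszul_im (f finset.set0) ->
  exists2 g, ext_homog 1 g & koszul g = f.
Proof.
move=> hf [u fE].
pose g : Omega := [ffun A : {set 'I_n} =>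
  \sum_k (if A == [set k]%SET then u k else 0)].
have hg : ext_homog 1 g.
  move=> A A1; rewrite ffunE big1 // => k _; case: eqP => // Ak.
  by rewrite Ak cards1 in A1.
exists g => //; apply/ffunP => A.
have [A0|A0] := eqVneq #|A| 0%N; last by rewrite hf // (koszul_homog hg).
have -> : A = finset.set0 by apply/eqP; rewrite -cards_eq0 A0.
rewrite fE /koszul sum_ffunE; apply: eq_bigr => k _.
rewrite !ffunE inE /ext_sign (_ : [set _ in _ | _]%SET = finset.set0); last first.
  by apply/setP => l; rewrite !inE.
rewrite cards0 expr0 scale1r finset.setU0 (bigD1 k) //= eqxx big1 ?addr0 // => l lk.
by case: eqP => // /finset.set1_inj kl; rewrite kl eqxx in lk.
Qed.

Definition koszul_boundary (i : nat) f : Prop :=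
  exists2 g, ext_homog i.+1 g & koszul g = f.

End Koszul.

Lemma koszul_map (W W' : lmodType K) (z : 'I_n -> {linear W -> W})
    (z' : 'I_n -> {linear W' -> W'}) (u : {linear W -> W'}) f :
  (forall k w, u (z k w) = z' k (u w)) ->
  koszul z' (ext_map u f) = ext_map u (koszul z f).
Proof.
move=> uz; rewrite /koszul linear_sum; apply: eq_bigr => k _.
by rewrite -ext_map_contr; apply/ffunP => A; rewrite !ffunE uz.
Qed.

End Exterior.

(** * Counting the degrees with nonzero homology *)

Section DegreeCount.
Variable n : nat.
Local Notation deg := 'rV[int]_n.
Implicit Types (k : 'I_n) (E : {set 'I_n}) (a b : deg).

Definition unitdeg k : deg := delta_mx 0 k.
Definition totdeg a : int := \sum_k a 0 k.

Lemma totdegD a b : totdeg (a + b) = totdeg a + totdeg b.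
Proof. by rewrite /totdeg -big_split; apply: eq_bigr => k _; rewrite mxE. Qed.

Lemma totdegN a : totdeg (- a) = - totdeg a.
Proof. by rewrite /totdeg -sumrN; apply: eq_bigr => k _; rewrite mxE. Qed.

Lemma totdeg_unit k : totdeg (unitdeg k) = 1.
Proof.
rewrite /totdeg (bigD1 k) //= big1 => [|l lk]; first by rewrite mxE !eqxx addr0.
by rewrite mxE (negbTE lk) andbF.
Qed.

(* [h i E a] abstracts "the degree-a part of the i-th Koszul homology with
   respect to the variables in E is nonzero"; [h_split] and [h_lift] are read off
   the long exact sequence of the mapping cone of one variable. *)
Variables (h : nat -> {set 'I_n} -> deg -> Prop) (c : int).
Hypothesis h_le : forall i E a, h i E a -> (i <= #|E|)%N.
Hypothesis h_split : forall i k E a, k \notin E -> h i.+1 (k |: E) a ->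
  h i.+1 E a \/ h i E (a - unitdeg k).
Hypothesis h_lift : forall i k E a, k \notin E -> h i E a ->
  h i E (a - unitdeg k) \/ h i (k |: E) a.
Hypothesis h_bounded : forall i E a, h i E a -> c < totdeg a.

(** Each failure to lift lowers the total degree by one, and it stays above c. This is where
    boundedness below enters the count. *)
Lemma degree_lift_iter i k E a : k \notin E -> h i E a ->
  exists t : nat, h i (k |: E) (a - unitdeg k *+ t).
Proof.
move=> kE; have [N] := ssrnat.ubnP `|totdeg a - c|%N.
elim: N a => [|N IHN] a; first by rewrite ltn0.
move=> aN ha.
have ac := h_bounded ha.
have [ha'|ha'] := h_lift kE ha; last by exists 0%N; rewrite subr0.
have [|t ht] := IHN _ _ ha'.
  by have := h_bounded ha'; rewrite totdegD totdegN totdeg_unit; lia.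
by exists t.+1; rewrite mulrS opprD addrA.
Qed.

(** The degrees in [L] share their k-th coordinate, so two of them differ in another one; lifting
    moves only the k-th coordinate, hence keeps them distinct. *)
Lemma degree_lift_seq i k E a (L : seq deg) : k \notin E -> uniq L ->
  (forall b, b \in L -> h i E b /\ b 0 k = a 0 k) ->
  exists L' : seq deg, [/\ uniq L', size L' = size L &
    forall b', b' \in L' -> h i (k |: E) b' /\
      exists2 b, b \in L & b' 0 k <= a 0 k /\ forall l, l != k -> b' 0 l = b 0 l].
Proof.
move=> kE uL hL.
have [t ht] : exists t : deg -> nat, forall b, b \in L ->
    h i (k |: E) (b - unitdeg k *+ t b).
  have /choice[t ht] : forall b, exists t, b \in L ->
      h i (k |: E) (b - unitdeg k *+ t).
    move=> b; have [/hL[hb _]|_] := boolP (b \in L); last by exists 0%N.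
    by have [t ht] := degree_lift_iter kE hb; exists t.
  by exists t.
have Dl b l : l != k -> (b - unitdeg k *+ t b) 0 l = b 0 l.
  by move=> lk; rewrite !mxE mulmxnE mxE (negbTE lk) andbF mul0rn subr0.
exists [seq b - unitdeg k *+ t b | b <- L]; split.
- rewrite map_inj_in_uniq // => b b' bL b'L bb'.
  apply/rowP => l; have [->|lk] := eqVneq l k.
    by rewrite (hL b bL).2 (hL b' b'L).2.
  by rewrite -(Dl b l lk) -(Dl b' l lk) bb'.
- by rewrite size_map.
- move=> _ /mapP[b bL ->]; split; first exact: ht.
  exists b => //; split=> [|l]; last exact: Dl.
  by rewrite -(hL b bL).2 !mxE mulmxnE mxE !eqxx /= lerBlDr lerDl mulrn_wge0.
Qed.

(** The offset [#|E|] allows a variable to be set aside: once in [E] it accounts for one exterior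
    degree, and its coordinate, being outside [s], is pinned to that of [a]. The pinned coordinate
    keeps the two lists of Pascal's rule disjoint. *)
Lemma degree_count (s : seq 'I_n) E p a : uniq s -> {in s, forall k, k \notin E} ->
  h (#|E| + p) ([set x in s] :|: E)%SET a -> forall i,
  exists L : seq deg, [/\ uniq L, size L = 'C(p, i) &
    forall b, b \in L -> h (#|E| + i) ([set x in s] :|: E)%SET b /\
      forall k, k \notin s -> b 0 k = a 0 k].
Proof.
have base s' E' a' : h (#|E'| + 0) s' a' -> forall i,
    exists L : seq deg, [/\ uniq L, size L = 'C(0, i) &
      forall b, b \in L -> h (#|E'| + i) s' b /\ b = a'].
  move=> ha [|i]; last by exists [::].
  by exists [:: a']; split=> // b; rewrite inE => /eqP->.
elim: s E p a => [|k s IHs] E p a /=.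
  move=> _ _; rewrite (_ : [set x in [::]] :|: E = E)%SET; last first.
    by apply/setP => x; rewrite !inE.
  move=> ha i; have p0 : p = 0%N.
    apply/eqP; move: (h_le ha).
    by rewrite -[X in (_ <= X)%N -> _]addn0 leq_add2l leqn0.
  rewrite p0 in ha *; have [L [uL sL hL]] := base _ _ _ ha i.
  by exists L; split=> // b /hL[hb bE]; split=> //; rewrite bE.
case/andP=> ks us sE.
have kE : k \notin E by apply: sE; rewrite mem_head.
have sE' : {in s, forall l, l \notin E} by move=> l ls; apply: sE; rewrite inE ls orbT.
set F := ([set x in s] :|: E)%SET.
have -> : ([set x in k :: s] :|: E = k |: F)%SET.
  by apply/setP => x; rewrite !inE orbA.
have kF : k \notin F by rewrite !inE negb_or ks.
case: p => [|p] ha i.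
  have [L [uL sL hL]] := base _ _ _ ha i.
  by exists L; split=> // b /hL[hb bE]; split=> //; rewrite bE.
(* If a class of the same exterior degree and the same degree [a] exists without k, induction gives
   all the required degrees, and each is lifted along k. *)
rewrite addnS in ha; have [ha'|ha'] := h_split kF ha.
  rewrite -addnS in ha'.
  have [L [uL sL hL]] := IHs E p.+1 a us sE' ha' i.
  have [b /hL[hb Lb]|L' [uL' sL' hL']] := @degree_lift_seq (#|E| + i) k F a L kF uL.
    by split=> //; apply: Lb.
  exists L'; split=> //; first by rewrite sL'.
  move=> b' /hL'[hb' [b /hL[hb Lb] [_ bb']]]; split=> // l.
  by rewrite inE negb_or => /andP[lk ls]; rewrite bb' // Lb.
(* Otherwise there is a class without k in degree a - e_k. The degrees that it yields have, after
   lifting, k-th coordinate strictly below a_k. *)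
have [L [uL sL hL]] := IHs E p _ us sE' ha' i.
have [b /hL[hb Lb]|L1 [uL1 sL1 hL1]] :=
    @degree_lift_seq (#|E| + i) k F (a - unitdeg k) L kF uL.
  by split=> //; apply: Lb.
have L1E b : b \in L1 ->
    [/\ h (#|E| + i) (k |: F) b, b 0 k < a 0 k &
        forall l, l \notin k :: s -> b 0 l = a 0 l].
  move=> /hL1[hb [b' /hL[hb' Lb'] [bk bb']]]; split=> // [|l].
    by move: bk; rewrite !mxE !eqxx /=; lia.
  rewrite inE negb_or => /andP[lk ls]; rewrite bb' // Lb' // !mxE.
  by rewrite (negbTE lk) andbF subr0.
case: i => [|i] in L uL sL hL L1 uL1 sL1 hL1 L1E *.
  exists L1; split=> // [|b /L1E[hb _ bl]]; first by rewrite sL1 sL !bin0.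
  by split.
have kFE : (k |: F = [set x in s] :|: (k |: E))%SET by rewrite finset.setUCA.
have skE : {in s, forall l, l \notin (k |: E)%SET}.
  move=> l ls; rewrite !inE negb_or sE' // andbT.
  by apply: contraNneq ks => <-.
have ckE : #|(k |: E)%SET| = #|E|.+1 by rewrite cardsU1 kE.
(* Moving k into [E] raises the offset and lowers p by one, so this is the original class again; the
   degrees it yields have k-th coordinate exactly a_k. *)
have ha2 : h (#|(k |: E)%SET| + p) ([set x in s] :|: (k |: E))%SET a.
  by rewrite -kFE ckE addSn.
have [L2 [uL2 sL2 hL2]] := IHs (k |: E)%SET p a us skE ha2 i.
exists (L1 ++ L2); split=> [||b].
- rewrite cat_uniq uL1 uL2 andbT; apply/hasPn => b /hL2[_ /(_ k ks) bk].
  by apply/negP => /L1E[_ bk' _]; move: bk'; rewrite bk ltxx.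
- by rewrite size_cat sL1 sL sL2 binS.
rewrite mem_cat => /orP[/L1E[hb _ bl]|/hL2[hb bl]]; first by split.
rewrite -kFE ckE addSn -addnS in hb; split=> // l.
by rewrite inE negb_or => /andP[_ ls]; apply: bl.
Qed.

Lemma degree_count_setT p a : h p finset.setT a -> forall i,
  exists L : seq deg, [/\ uniq L, size L = 'C(p, i) &
    forall b, b \in L -> h i finset.setT b].
Proof.
have eT : ([set x in enum 'I_n] :|: finset.set0 = finset.setT)%SET.
  by apply/setP => x; rewrite !inE mem_enum.
have c0 : #|@finset.set0 'I_n| = 0%N by rewrite cards0.
move=> ha i; have [|||L [uL sL hL]] :=
    @degree_count (enum 'I_n) finset.set0 p a _ _ _ i.
- exact: enum_uniq.
- by move=> k _; rewrite inE.
- by rewrite eT c0.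
by exists L; split=> // b /hL[]; rewrite eT c0.
Qed.

End DegreeCount.

(** * Sums of homogeneous elements *)

Section Gradings.
Variables (I : eqType) (V : zmodType) (G : I -> V -> Prop).

Inductive homog_span : V -> Prop :=
| homog_span0 : homog_span 0
| homog_spanS a x y : G a x -> homog_span y -> homog_span (x + y).

Lemma homog_span1 a x : G a x -> homog_span x.
Proof. by move=> Gx; rewrite -[x]addr0; apply: homog_spanS Gx homog_span0. Qed.

Lemma homog_spanD x y : homog_span x -> homog_span y -> homog_span (x + y).
Proof.
move=> Hx Hy; elim: Hx => [|a u v Gu _ IHv]; first by rewrite add0r.
by rewrite -addrA; apply: homog_spanS Gu IHv.
Qed.

Lemma homog_span_sum (J : Type) (r : seq J) (P : pred J) (F : J -> V) :
  (forall j, P j -> homog_span (F j)) -> homog_span (\sum_(j <- r | P j) F j).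
Proof.
move=> HF; elim/big_ind: _ => [|x y|//]; first exact: homog_span0.
exact: homog_spanD.
Qed.

Lemma sum_sub_seq (L L' : seq I) (g : I -> V) :
  uniq L -> uniq L' -> {subset L <= L'} ->
  \sum_(a <- L') (if a \in L then g a else 0) = \sum_(a <- L) g a.
Proof.
move=> uL uL' LL'; rewrite -big_mkcond -big_filter.
apply: perm_big; apply: uniq_perm => [||a]; rewrite ?filter_uniq //.
by rewrite mem_filter; case: (boolP (a \in L)) => // /LL' ->.
Qed.

Hypothesis G0 : forall a, G a 0.
Hypothesis GD : forall a x y, G a x -> G a y -> G a (x + y).

(** Summands of equal degree are merged, which needs only that each component is closed under
    addition. *)
Lemma homog_span_uniq x : homog_span x ->
  exists (L : seq I) (g : I -> V),
    [/\ uniq L, forall a, G a (g a) & x = \sum_(a <- L) g a].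
Proof.
elim=> [|a {}x y Gx _ [L [g [uL Gg ->]]]].
  by exists [::], (fun=> 0); split=> //; rewrite big_nil.
exists (undup (a :: L)), (fun b => (if b \in [:: a] then x else 0) +
  (if b \in L then g b else 0)); split=> [|b|].
- exact: undup_uniq.
- apply: GD; last by case: ifP.
  by rewrite inE; case: eqP => [->|].
- rewrite big_split !sum_sub_seq ?undup_uniq ?big_seq1 // => b.
    by rewrite mem_undup inE orbC => ->.
  by rewrite mem_undup !inE => ->.
Qed.

Definition homog_direct : Prop := forall (L : seq I) (g : I -> V),
  uniq L -> (forall a, G a (g a)) -> \sum_(a <- L) g a = 0 ->
  forall a, a \in L -> g a = 0.

End Gradings.

(** Linear independence of classes modulo B, stated on representatives so that no quotient of the
    Koszul complex has to be formed. *)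
Definition indep_mod (K : fieldType) (V : lmodType K) (B : V -> Prop) (k : nat)
    (v : 'I_k -> V) : Prop :=
  forall d : 'I_k -> K, B (\sum_t d t *: v t) -> forall t, d t = 0.

(** * Koszul homology of a graded, bounded below module *)

Section GradedKoszul.
Variables (K : fieldType) (n : nat) (W : lmodType K).
Variable z : 'I_n -> {linear W -> W}.
Hypothesis zC : forall k l w, z k (z l w) = z l (z k w).
Local Notation deg := 'rV[int]_n.
Variable G : deg -> W -> Prop.
Hypothesis G0 : forall a, G a 0.
Hypothesis GD : forall a x y, G a x -> G a y -> G a (x + y).
Hypothesis GZ : forall a c x, G a x -> G a (c *: x).
Hypothesis Gz : forall a k x, G a x -> G (a + unitdeg k) (z k x).
Hypothesis Gspan : forall x, homog_span G x.
Hypothesis Gdirect : homog_direct G.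
Variable c : int.
Hypothesis Gbounded : forall a x, totdeg a <= c -> G a x -> x = 0.

Local Notation Omega := {ffun {set 'I_n} -> W}.
Implicit Types (f g : Omega) (A E : {set 'I_n}) (k l : 'I_n) (a b : deg).

Definition setdeg A : deg := \sum_(k in A) unitdeg k.

Lemma setdegU1 k A : k \notin A -> setdeg (k |: A) = unitdeg k + setdeg A.
Proof. exact: big_setU1. Qed.

(** The symbol e_k is given the degree of z_k, so that the differential preserves degrees. *)
Definition ext_deg a f : Prop := forall A, G (a - setdeg A) (f A).

Lemma ext_deg0 a : ext_deg a 0.
Proof. by move=> A; rewrite ffunE. Qed.

Lemma ext_degD a f g : ext_deg a f -> ext_deg a g -> ext_deg a (f + g).
Proof. by move=> df dg A; rewrite ffunE; apply: GD. Qed.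

Lemma ext_degZ a x f : ext_deg a f -> ext_deg a (x *: f).
Proof. by move=> df A; rewrite ffunE; apply: GZ. Qed.

Lemma ext_degB a f g : ext_deg a f -> ext_deg a g -> ext_deg a (f - g).
Proof. by move=> df dg; rewrite -scaleN1r; apply/ext_degD/ext_degZ. Qed.

Lemma contr_deg a k f : ext_deg a f -> ext_deg (a - unitdeg k) (contr k f).
Proof.
move=> df A; rewrite ffunE; case: ifPn => kA; first exact: G0.
by apply: GZ; rewrite -addrA -opprD -setdegU1.
Qed.

Lemma wedge_deg a k f : ext_deg (a - unitdeg k) f -> ext_deg a (wedge k f).
Proof.
move=> df A; rewrite ffunE; case: ifPn => kA; last exact: G0.
apply: GZ; have := df (A :\ k).
by rewrite -addrA -opprD -setdegU1 ?finset.setD1K // !inE eqxx.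
Qed.

Lemma koszul_deg a f : ext_deg a f -> ext_deg a (koszul z f).
Proof.
move=> df; rewrite /koszul; elim/big_ind: _ => [|g h|k _].
- exact: ext_deg0.
- exact: ext_degD.
move=> A; rewrite ffunE; have := Gz k (contr_deg k df A).
by rewrite addrAC subrK.
Qed.

(* [contr l g = 0] for all [l] outside [E] says that [g] only involves the
   exterior variables in [E]; on such [g] the full differential is the Koszul
   differential of the variables in [E]. *)
Definition koszul_nonzero i E a : Prop := exists f,
  [/\ ext_homog i f /\ ext_deg a f,
      forall l, l \notin E -> contr l f = 0,
      koszul z f = 0 &
      forall g, ext_homog i.+1 g -> ext_deg a g ->
        (forall l, l \notin E -> contr l g = 0) -> koszul z g <> f].

Lemma koszul_nonzero_le i E a : koszul_nonzero i E a -> (i <= #|E|)%N.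
Proof.
case=> f [[hf _] fE _ fb]; rewrite leqNgt; apply/negP => Ei.
apply: (fb 0); rewrite ?linear0.
- by move=> A _; rewrite ffunE.
- exact: ext_deg0.
- by move=> l _; rewrite linear0.
- by rewrite (contr_off hf fE Ei).
Qed.

(** Either iota_k f is a cycle over E that does not bound, or iota_k f = d g, and then f + d (e_k /\
    g) is a homologous cycle that no longer involves e_k. *)
Lemma koszul_nonzero_split i k E a : k \notin E ->
  koszul_nonzero i.+1 (k |: E) a ->
  koszul_nonzero i.+1 E a \/ koszul_nonzero i E (a - unitdeg k).
Proof.
move=> kE [f [[hf df] fE zf fb]].
have kfE l : l \notin E -> contr l (contr k f) = 0.
  move=> lE; have [->|lk] := eqVneq l k; first exact: contr_contr.
  by rewrite contrC // fE ?linear0 // !inE negb_or lk.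
have [[g [hg dg gE zg]]|nb] := pselect (exists g, [/\ ext_homog i.+1 g,
    ext_deg (a - unitdeg k) g, forall l, l \notin E -> contr l g = 0 &
    koszul z g = contr k f]); last first.
  right; exists (contr k f); split=> //.
  - by split; [apply: contr_homog|apply: contr_deg].
  - by rewrite koszul_contr zf !linear0.
  - by move=> g hg dg gE zg; apply: nb; exists g.
have hw := wedge_homog k hg; have dw := wedge_deg dg.
have wE l : l \notin (k |: E)%SET -> contr l (wedge k g) = 0.
  rewrite !inE negb_or => /andP[lk lE].
  by rewrite contr_wedgeC // gE // !linear0 ?oppr0.
have kw : contr k (wedge k g) = g by rewrite contr_wedge // gE.
left; exists (f + koszul z (wedge k g)); split.
- split; first by apply: ext_homogD => //; apply: koszul_homog.
  by apply: ext_degD => //; apply: koszul_deg.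
- move=> l lE; have [->|lk] := eqVneq l k; rewrite linearD /=.
    by rewrite -[X in _ + X]opprK -koszul_contr kw zg subrr.
  have lkE : l \notin (k |: E)%SET by rewrite !inE negb_or lk.
  by rewrite -[X in _ + X]opprK -koszul_contr wE // fE // !linear0 ?oppr0 addr0.
- by rewrite linearD /= zf koszul_koszul // addr0.
move=> u hu du uE zu; apply: (fb (u - wedge k g)).
- exact: ext_homogB.
- exact: ext_degB.
- move=> l lkE; rewrite linearB /= wE // uE ?subr0 //.
  by move: lkE; rewrite !inE negb_or => /andP[].
- by rewrite linearB /= zu addrK.
Qed.

(** If f becomes a boundary d g once k is adjoined, then iota_k g is a cycle over E in degree a -
    e_k. It does not bound: iota_k g = d u would make g + d (e_k /\ u) free of e_k, with boundary
    f. *)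
Lemma koszul_nonzero_lift i k E a : k \notin E -> koszul_nonzero i E a ->
  koszul_nonzero i E (a - unitdeg k) \/ koszul_nonzero i (k |: E) a.
Proof.
move=> kE [f [[hf df] fE zf fb]].
have fkE l : l \notin (k |: E)%SET -> contr l f = 0.
  by rewrite !inE negb_or => /andP[_ /fE].
have [[g [hg dg gE zg]]|nb] := pselect (exists g, [/\ ext_homog i.+1 g,
    ext_deg a g, forall l, l \notin (k |: E)%SET -> contr l g = 0 &
    koszul z g = f]); last first.
  by right; exists f; split=> // g hg dg gE zg; apply: nb; exists g.
left; exists (contr k g).
have kgE l : l \notin E -> contr l (contr k g) = 0.
  move=> lE; have [->|lk] := eqVneq l k; first exact: contr_contr.
  by rewrite contrC // gE ?linear0 // !inE negb_or lk.
split=> //.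
- by split; [apply: contr_homog|apply: contr_deg].
- by rewrite koszul_contr zg fE // oppr0.
move=> u hu du uE zu.
have hw := wedge_homog k hu; have dw := wedge_deg du.
have kw : contr k (wedge k u) = u by rewrite contr_wedge // uE.
apply: (fb (g + koszul z (wedge k u))).
- by apply: ext_homogD => //; apply: koszul_homog.
- by apply: ext_degD => //; apply: koszul_deg.
- move=> l lE; rewrite linearD /= -[X in _ + X]opprK -koszul_contr.
  have [->|lk] := eqVneq l k; first by rewrite kw zu subrr.
  rewrite gE; last by rewrite !inE negb_or lk.
  by rewrite contr_wedgeC // uE // !linear0 ?oppr0 addr0.
- by rewrite linearD /= zg koszul_koszul // addr0.
Qed.

Lemma totdeg_setdeg A : 0 <= totdeg (setdeg A).
Proof.
rewrite /setdeg; elim/big_ind: _ => [|a b ha hb|k _].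
- by rewrite /totdeg big1 // => k _; rewrite mxE.
- by rewrite totdegD addr_ge0.
- by rewrite totdeg_unit.
Qed.

(** The coefficients of a form of degree a have total degree at most that of a, so they all vanish
    when the latter is at most c. *)
Lemma koszul_nonzero_bounded i E a : koszul_nonzero i E a -> c < totdeg a.
Proof.
case=> f [[hf df] fE _ fb]; rewrite ltNge; apply/negP => ac.
apply: (fb 0); rewrite ?linear0.
- by move=> A _; rewrite ffunE.
- exact: ext_deg0.
- by move=> l _; rewrite linear0.
apply/ffunP => A; rewrite ffunE; apply/esym/(Gbounded _ (df A)).
apply: le_trans ac; rewrite totdegD totdegN.
by rewrite lerBlDr lerDl totdeg_setdeg.
Qed.

Lemma koszul_nonzero_count p a : koszul_nonzero p finset.setT a -> forall i,
  exists L : seq deg, [/\ uniq L, size L = 'C(p, i) &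
    forall b, b \in L -> koszul_nonzero i finset.setT b].
Proof.
apply: (degree_count_setT koszul_nonzero_le) => //.
- exact: koszul_nonzero_split.
- exact: koszul_nonzero_lift.
- exact: koszul_nonzero_bounded.
Qed.

Lemma ext_direct : homog_direct ext_deg.
Proof.
move=> L g uL dg sg a aL; apply/ffunP => A; rewrite ffunE.
pose L' := [seq b - setdeg A | b <- L].
have := Gdirect (L := L') (g := fun b => g (b + setdeg A) A).
rewrite -[in g a A](subrK (setdeg A) a); apply.
- by rewrite map_inj_uniq //; apply: addIr.
- by move=> b; have := dg (b + setdeg A) A; rewrite addrK.
- rewrite big_map; under eq_bigr do rewrite subrK.
  by have /ffunP/(_ A) := sg; rewrite sum_ffunE ffunE.
- exact: map_f.
Qed.

Lemma ext_span i f : ext_homog i f ->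
  homog_span (fun a g => ext_homog i g /\ ext_deg a g) f.
Proof.
move=> hf; pose e A w : Omega := [ffun B : {set 'I_n} => if B == A then w else 0].
have -> : f = \sum_A e A (f A).
  apply/ffunP => B; rewrite sum_ffunE (bigD1 B) //= big1 => [|A AB].
    by rewrite ffunE eqxx addr0.
  by rewrite ffunE eq_sym (negbTE AB).
apply: homog_span_sum => A _; have [Ai|/hf->] := eqVneq #|A| i; last first.
  rewrite (_ : e A 0 = 0); first exact: homog_span0.
  by apply/ffunP => B; rewrite !ffunE; case: ifP.
elim: (Gspan (f A)) => [|a x y Gx _ IHy].
  rewrite (_ : e A 0 = 0); first exact: homog_span0.
  by apply/ffunP => B; rewrite !ffunE; case: ifP.
rewrite (_ : e A (x + y) = e A x + e A y); last first.
  by apply/ffunP => B; rewrite !ffunE; case: ifP; rewrite ?addr0.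
apply: (@homog_spanS _ _ _ (a + setdeg A)) IHy.
split=> B; first by rewrite ffunE; have [->|//] := eqVneq B A; rewrite Ai eqxx.
by rewrite ffunE; have [->|//] := eqVneq B A; rewrite addrK.
Qed.

Lemma ext_uniq i f : ext_homog i f -> exists (L : seq deg) (g : deg -> Omega),
  [/\ uniq L, forall a, ext_homog i (g a) /\ ext_deg a (g a) &
      f = \sum_(a <- L) g a].
Proof.
move=> /ext_span; apply: homog_span_uniq => [a|a x y [hx dx] [hy dy]].
  by split; [move=> A _; rewrite ffunE|apply: ext_deg0].
by split; [apply: ext_homogD|apply: ext_degD].
Qed.

(** The homogeneous parts of a cycle are cycles because d preserves degrees; if each of them
    bounded, so would their sum. *)
Lemma koszul_nonzero_ex i f : ext_homog i f -> koszul z f = 0 ->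
  ~ koszul_boundary z i f ->
  exists a, koszul_nonzero i finset.setT a.
Proof.
move=> hf; have [L [g [uL hg ->]]] := ext_uniq hf => zf fb.
have zg a : a \in L -> koszul z (g a) = 0.
  apply: (ext_direct uL (g := fun a => koszul z (g a))) => [b|].
    exact/koszul_deg/(hg b).2.
  by rewrite -[RHS]zf linear_sum.
apply: contrapT => nex.
have gb a : a \in L -> exists2 u, ext_homog i.+1 u & koszul z u = g a.
  move=> aL; apply: contrapT => nb; apply: nex; exists a, (g a); split.
  - exact: hg.
  - by move=> l; rewrite inE.
  - exact: zg.
  - by move=> u hu _ _ zu; apply: nb; exists u.
have [u hu zu] : exists2 u, ext_homog i.+1 u & koszul z u = \sum_(a <- L) g a.
  elim: {uL fb nex zf zg hf} L gb => [|a L IHL] gb.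
    by exists 0; rewrite ?big_nil ?linear0 // => A _; rewrite ffunE.
  have [u hu zu] := gb a (mem_head a L).
  have [|v hv zv] := IHL; first by move=> b bL; apply: gb; rewrite inE bL orbT.
  exists (u + v); first exact: ext_homogD.
  by rewrite linearD /= zu zv big_cons.
by apply: fb; exists u.
Qed.

(** A relation modulo boundaries splits by degree. In degree b it makes a multiple of one
    representative a boundary, and a nonzero coefficient can be divided out. *)
Lemma koszul_nonzero_indep i (L : seq deg) : uniq L ->
  (forall b, b \in L -> koszul_nonzero i finset.setT b) ->
  exists v : 'I_(size L) -> Omega,
    (forall t, ext_homog i (v t) /\ koszul z (v t) = 0) /\
    indep_mod (koszul_boundary z i) v.
Proof.
move=> uL hL.
have [F FL] : exists F : deg -> Omega, forall b, b \in L ->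
    [/\ ext_homog i (F b) /\ ext_deg b (F b), koszul z (F b) = 0 &
      forall g, ext_homog i.+1 g -> ext_deg b g -> koszul z g <> F b].
  have /choice[F FL] : forall b, exists f, b \in L ->
      [/\ ext_homog i f /\ ext_deg b f, koszul z f = 0 &
      forall g, ext_homog i.+1 g -> ext_deg b g -> koszul z g <> f].
    move=> b; have [/hL[f [hf _ zf fb]]|_] := boolP (b \in L); last by exists 0.
    exists f => _; split=> // g hg dg; apply: fb => // l.
    by rewrite inE.
  by exists F.
exists (fun t => F (tnth (in_tuple L) t)); split=> [t|d [u hu]].
  by have [[hF _] zF _] := FL _ (mem_tnth t (in_tuple L)).
pose d' b := if insub (index b L) is Some t then d t else 0.
have d'E t : d' (tnth (in_tuple L) t) = d t.
  rewrite /d' (tnth_nth 0) index_uniq //= ?valK //.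
have -> : \sum_t d t *: F (tnth (in_tuple L) t) = \sum_(b <- L) d' b *: F b.
  by rewrite [RHS]big_tnth; apply: eq_bigr => t _; rewrite d'E.
have [Lu [g [uLu hg ->]]] := ext_uniq hu => zu t.
rewrite -d'E; move: (tnth _ t) (mem_tnth t (in_tuple L)) => b bL.
pose L' := undup (L ++ Lu).
have bL' : b \in L' by rewrite mem_undup mem_cat bL.
(* The degree-a part of the relation minus the boundary; a degree missing from one of the two lists
   contributes 0 to that side. *)
pose g' a := (if a \in L then d' a *: F a else 0) -
  (if a \in Lu then koszul z (g a) else 0).
apply/eqP; apply: contrapT => /negP db.
have : g' b = 0.
  apply: (@ext_direct L' g' (undup_uniq _)) => // [a|].
    rewrite /g'; apply: ext_degB.
      case: ifP => [/FL[[_ dF] _ _]|_]; first exact: ext_degZ.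
      exact: ext_deg0.
    case: ifP => _; last exact: ext_deg0.
    exact/koszul_deg/(hg a).2.
  have sL : {subset L <= L'} by move=> a aL; rewrite mem_undup mem_cat aL.
  have sLu : {subset Lu <= L'} by move=> a aL; rewrite mem_undup mem_cat aL orbT.
  by rewrite sumrB !sum_sub_seq ?undup_uniq // -zu [koszul z _]linear_sum subrr.
rewrite /g' bL => /eqP; rewrite subr_eq0 => /eqP bE.
have [_ _ Fb] := FL b bL.
apply: (Fb ((d' b)^-1 *: (if b \in Lu then g b else 0))).
- apply: ext_homogZ; case: ifP => _; first exact: (hg b).1.
  by move=> A _; rewrite ffunE.
- apply: ext_degZ; case: ifP => _; first exact: (hg b).2.
  exact: ext_deg0.
- rewrite linearZ /= (fun_if (koszul z)) linear0 -bE.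
  by rewrite scalerA mulVf // scale1r.
Qed.

End GradedKoszul.

(** * The graded tensor product over K *)

Section TensorOverField.
Variables (K : fieldType) (n : nat).
Local Notation S := {mpoly K[n]}.
Local Notation "M '_K'" := (restr_scalars (@mpolyC n K) M : lmodType K)
  (at level 2, format "M '_K'").

Fact scal_linear (M : lmodType S) (s : S) : linear (fun x : M _K => s *: (x : M) : M _K).
Proof.
move=> a x y; rewrite -[LHS]/(s *: (a%:MP *: (x : M) + y)) scalerDr.
by rewrite scalerA mulrC -scalerA.
Qed.

Definition scal (M : lmodType S) (s : S) : {linear M _K -> M _K} :=
  HB.pack_for {linear M _K -> M _K} (fun x : M _K => s *: (x : M) : M _K)
    (GRing.isLinear.Build K (M _K) (M _K) *:%R _ (@scal_linear M s)).

Lemma scalE (M : lmodType S) (s : S) (x : M) : scal M s x = s *: x.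
Proof. by []. Qed.

Variables M N : lmodType S.
Local Notation W := (tensor (M _K) (N _K)).

Definition actl (s : S) : {linear W -> W} := tmap (scal M s) idfun.
Definition actr (s : S) : {linear W -> W} := tmap idfun (scal N s).

Lemma actlE s (x : M _K) (y : N _K) : actl s (tens x y) = tens (s *: (x : M) : M _K) y.
Proof. exact: tmapE. Qed.

Lemma actrE s (x : M _K) (y : N _K) : actr s (tens x y) = tens x (s *: (y : N) : N _K).
Proof. exact: tmapE. Qed.

Lemma actlC s t w : actl s (actl t w) = actl t (actl s w).
Proof.
by apply: tmap_square => // x; rewrite !scalE !scalerA mulrC.
Qed.

Lemma actrC s t w : actr s (actr t w) = actr t (actr s w).
Proof.
by apply: tmap_square => // x; rewrite !scalE !scalerA mulrC.
Qed.

Lemma actlrC s t w : actl s (actr t w) = actr t (actl s w).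
Proof. exact: tmap_square. Qed.

Definition zdiff (k : 'I_n) : {linear W -> W} := actl 'X_k \- actr 'X_k.

Lemma zdiffE k w : zdiff k w = actl 'X_k w - actr 'X_k w.
Proof. by []. Qed.

Lemma zdiff0 k : zdiff k 0 = 0.
Proof. exact: raddf0. Qed.

Lemma zdiffD k v w : zdiff k (v + w) = zdiff k v + zdiff k w.
Proof. exact: raddfD. Qed.

Lemma zdiffC k l w : zdiff k (zdiff l w) = zdiff l (zdiff k w).
Proof.
have actlB a u v : actl a (u - v) = actl a u - actl a v by exact: linearB.
have actrB a u v : actr a (u - v) = actr a u - actr a v by exact: linearB.
rewrite 4!zdiffE 2!actlB 2!actrB (actlC 'X_l) (actrC 'X_l) 2!actlrC.
by rewrite 2!opprB addrACA [RHS]addrACA; congr (_ + _); rewrite addrC.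
Qed.

End TensorOverField.

Section ZdiffNaturality.
Variables (K : fieldType) (n : nat).
Local Notation S := {mpoly K[n]}.
Local Notation "M '_K'" := (restr_scalars (@mpolyC n K) M : lmodType K)
  (at level 2, format "M '_K'").
Variables (M M' N N' : lmodType S).
Variables (f : {linear M _K -> M' _K}) (g : {linear N _K -> N' _K}) (k : 'I_n).

Lemma tmap_zdiff :
  (forall x, f (scal M 'X_k x) = scal M' 'X_k (f x)) ->
  (forall y, g (scal N 'X_k y) = scal N' 'X_k (g y)) ->
  forall w, tmap f g (zdiff M N k w) = zdiff M' N' k (tmap f g w).
Proof.
move=> fX gX w; rewrite !zdiffE (raddfB (tmap f g)).
by congr (_ - _); apply: tmap_square.
Qed.

End ZdiffNaturality.

Section GradedTensor.
Variables (K : fieldType) (n : nat).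
Local Notation S := {mpoly K[n]}.
Local Notation deg := 'rV[int]_n.
Local Notation "M '_K'" := (restr_scalars (@mpolyC n K) M : lmodType K)
  (at level 2, format "M '_K'").

Section Components.
Variable M : grmod K n.

Lemma grcomp0 a : grcomp (g := M) a 0.
Proof. exact: (@grcomp_zmod K n M a).1. Qed.

Lemma grcompD a (x y : M) : grcomp a x -> grcomp a y -> grcomp a (x + y).
Proof.
move=> hx hy; have sub := (@grcomp_zmod _ _ M a).2.
by rewrite -[y]opprK -[- y]sub0r; apply: (sub _ _ hx); apply: sub => //; apply: grcomp0.
Qed.

Lemma mpoly_comp_C (c : K) : mpoly_comp (n := n) 0 c%:MP.
Proof.
move=> m; rewrite msuppC; case: eqP => // _; rewrite inE => /eqP ->.
by apply/rowP => k; rewrite !mxE mnm0E.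
Qed.

Lemma mpoly_comp_X k : mpoly_comp (unitdeg k) ('X_k : S).
Proof.
move=> m; rewrite msuppX inE => /eqP ->.
by apply/rowP => l; rewrite !mxE mnm1E [k == l]eq_sym; case: (l == k).
Qed.

Lemma grcompZ a (c : K) (x : M _K) : grcomp (g := M) a x -> grcomp (g := M) a (c *: x).
Proof. by move=> hx; have := grcomp_scale (@mpoly_comp_C c) hx; rewrite add0r. Qed.

Lemma grcompX a k (x : M) : grcomp a x -> grcomp (a + unitdeg k) ('X_k *: x).
Proof. by move=> hx; rewrite addrC; apply: grcomp_scale hx; apply: mpoly_comp_X. Qed.

(** Components are a function on all degrees, the list only witnessing finite support, so that two
    decompositions can be compared pointwise. *)
Definition decomposes (x : M) (g : deg -> M) : Prop :=
  (forall a, grcomp a (g a)) /\ exists L, [/\ uniq L,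
    forall a, a \notin L -> g a = 0 & x = \sum_(a <- L) g a].

Lemma decomposes_ex x : exists g, decomposes x g.
Proof.
have : homog_span (@grcomp K n M) x.
  have [A [f [hf ->]]] := grcomp_gen x.
  by apply: homog_span_sum => a _; apply: homog_span1 (hf a).
case/homog_span_uniq => [a|a u v|L [g [uL hg ->]]].
- exact: grcomp0.
- exact: grcompD.
exists (fun a => if a \in L then g a else 0); split=> [a|].
  by case: ifP => _ //; apply: grcomp0.
exists L; split=> // [a /negbTE->//|].
by apply: eq_big_seq => a ->.
Qed.

Lemma sum_zero_off (L L' : seq deg) (g : deg -> M) : uniq L -> uniq L' ->
  {subset L <= L'} -> (forall a, a \notin L -> g a = 0) ->
  \sum_(a <- L') g a = \sum_(a <- L) g a.
Proof.
move=> uL uL' LL' g0; rewrite -(sum_sub_seq g uL uL' LL').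
by apply: eq_bigr => a _; case: ifPn => // /g0.
Qed.

Lemma decomposesP (c : K) (x y : M _K) f g : decomposes x f -> decomposes y g ->
  decomposes (c *: x + y) (fun a => c *: (f a : M _K) + g a).
Proof.
move=> [hf [Lf [uf f0 ->]]] [hg [Lg [ug g0 ->]]]; split=> [a|].
  by apply: grcompD => //; apply: grcompZ.
pose L := undup (Lf ++ Lg); exists L.
have sf : {subset Lf <= L} by move=> a aL; rewrite mem_undup mem_cat aL.
have sg : {subset Lg <= L} by move=> a aL; rewrite mem_undup mem_cat aL orbT.
split=> [|a|]; first exact: undup_uniq.
  rewrite mem_undup mem_cat negb_or => /andP[/f0-> /g0->].
  by rewrite addr0; apply: (@scaler0 K (M _K)).
rewrite -(sum_zero_off uf (undup_uniq _) sf f0) -(sum_zero_off ug (undup_uniq _) sg g0).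
by rewrite (@scaler_sumr K (M _K)) -big_split.
Qed.

Lemma decomposes_uniq x f g : decomposes x f -> decomposes x g -> f =1 g.
Proof.
move=> df dg a; have := decomposesP (-1) df dg.
rewrite scaleN1r addNr => -[hfg [L [uL fg0 s0]]].
have : -1 *: (f a : M _K) + g a = 0.
  have [aL|/fg0//] := boolP (a \in L).
  exact: (grcomp_direct uL hfg (esym s0) aL).
by rewrite scaleN1r addrC => /eqP; rewrite subr_eq0 => /eqP.
Qed.

(** Decompositions are chosen arbitrarily; their uniqueness makes each component K-linear in the
    element. *)
Lemma grproj_ex : exists p : deg -> {linear M _K -> M _K},
  forall a b (x : M), grcomp b x -> p a x = if a == b then x else 0.
Proof.
have [d dP] := choice decomposes_ex.
have dlin a : linear ((fun x : M _K => d x a) : M _K -> M _K).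
  by move=> c x y; apply: decomposes_uniq (dP _) (decomposesP c (dP x) (dP y)) a.
exists (fun a => HB.pack_for {linear M _K -> M _K} ((fun x : M _K => d x a) : M _K -> M _K)
  (GRing.isLinear.Build K (M _K) (M _K) *:%R _ (dlin a))) => a b x hx /=.
apply: (decomposes_uniq (dP x) (g := fun a => if a == b then x else 0)).
split=> [a'|]; first by have [->|_] := eqVneq a' b; last exact: grcomp0.
exists [:: b]; split=> // [a'|]; first by rewrite inE => /negbTE->.
by rewrite big_seq1 eqxx.
Qed.

End Components.

Variables M N : grmod K n.
Local Notation W := (tensor ((M : lmodType S) _K) ((N : lmodType S) _K)).

Inductive tens_comp (a : deg) : W -> Prop :=
| tens_comp0 : tens_comp a 0
| tens_compS b (x : M) (y : N) w : grcomp b x -> grcomp (a - b) y ->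
    tens_comp a w -> tens_comp a (tens (x : M _K) (y : N _K) + w).

Lemma tens_compD a w w' : tens_comp a w -> tens_comp a w' -> tens_comp a (w + w').
Proof.
move=> hw hw'; elim: hw => [|b x y v hx hy _ IHv]; first by rewrite add0r.
by rewrite -addrA; apply: tens_compS hx hy IHv.
Qed.

Lemma tens_comp1 a b (x : M) (y : N) : grcomp b x -> grcomp (a - b) y ->
  tens_comp a (tens (x : M _K) (y : N _K)).
Proof.
by move=> hx hy; rewrite -[tens _ _]addr0; apply: tens_compS hx hy (tens_comp0 a).
Qed.

Lemma tens_compZ a (c : K) w : tens_comp a w -> tens_comp a (c *: w).
Proof.
elim=> [|b x y v hx hy _ IHv]; first by rewrite scaler0; apply: tens_comp0.
rewrite scalerDr -tensZl; apply: tens_compS hy IHv; exact: grcompZ.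
Qed.

Lemma tens_comp_zdiff a k w : tens_comp a w -> tens_comp (a + unitdeg k) (zdiff M N k w).
Proof.
elim=> [|b x y v hx hy _ IHv]; first by rewrite linear0; apply: tens_comp0.
rewrite linearD; apply: tens_compD => //.
rewrite zdiffE actlE actrE; apply: tens_compD.
  apply: (tens_comp1 (b := b + unitdeg k)); first exact: grcompX.
  by rewrite opprD addrACA subrr addr0.
rewrite -scaleN1r; apply/tens_compZ/(tens_comp1 hx).
by rewrite addrAC; apply: grcompX.
Qed.

Lemma tens_comp_span w : homog_span tens_comp w.
Proof.
elim/tensor_ind: w => [|x y w IHw]; first exact: homog_span0.
apply: homog_spanD => // {w IHw}.
have [f [hf [Lf [_ _ ->]]]] := decomposes_ex (x : M).
have [g [hg [Lg [_ _ ->]]]] := decomposes_ex (y : N).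
elim: Lf => [|a L IHL].
  by rewrite big_nil tens0l; apply: homog_span0.
rewrite big_cons tensDl; apply: homog_spanD => // {L IHL}.
elim: Lg => [|b L IHL].
  by rewrite big_nil tens0r; apply: homog_span0.
rewrite big_cons tensDr; apply: homog_spanD => //.
apply: (homog_span1 (a := a + b)); apply: (tens_comp1 (hf a)).
by rewrite addrAC subrr add0r.
Qed.

(* The degree-a projection of the tensor product is the infinite sum of the
   p_b (x) q_(a-b); a finite window L of degrees b suffices on a given element. *)
Lemma tens_comp_direct : homog_direct tens_comp.
Proof.
have [p pP] := grproj_ex M; have [q qP] := grproj_ex N.
pose P (L : seq deg) a w := \sum_(b <- L) tmap (p b) (q (a - b)) w.
have PD L a w w' : P L a (w + w') = P L a w + P L a w'.
  by rewrite /P -big_split; apply: eq_bigr => b _; rewrite linearD.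
have P0 L a : P L a 0 = 0 by rewrite /P big1 // => b _; rewrite linear0.
have window a w : tens_comp a w -> exists L0 : seq deg, forall L, uniq L ->
    {subset L0 <= L} -> forall a', P L a' w = if a' == a then w else 0.
  elim=> [|b x y v hx hy _ [L0 hL0]].
    by exists [::] => L _ _ a'; rewrite P0; case: ifP.
  exists (b :: L0) => L uL sL a'; rewrite PD hL0 //; last first.
    by move=> b' b'L; apply: sL; rewrite inE b'L orbT.
  have -> : P L a' (tens (x : M _K) (y : N _K)) =
      if a' == a then tens (x : M _K) (y : N _K) else 0.
    rewrite /P (bigD1_seq b) ?sL ?mem_head //= big1 ?addr0 => [|b' b'b].
      rewrite tmapE (pP _ _ _ hx) (qP _ _ _ hy) eqxx.
      by rewrite (inj_eq (addIr _)); case: ifP => // _; rewrite tens0r.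
    by rewrite tmapE (pP _ _ _ hx) (negbTE b'b) tens0l.
  by case: ifP => // _; rewrite addr0.
move=> L g uL hg sg.
have [L1 [uL1 hL1]] : exists L1 : seq deg, uniq L1 /\ forall a, a \in L -> forall a',
    P L1 a' (g a) = if a' == a then g a else 0.
  suff [L0 hL0] : exists L0 : seq deg, forall L1, uniq L1 -> {subset L0 <= L1} ->
      forall a, a \in L -> forall a', P L1 a' (g a) = if a' == a then g a else 0.
    exists (undup L0); split; first exact: undup_uniq.
    by apply: hL0; [apply: undup_uniq|move=> b; rewrite mem_undup].
  elim: L {uL sg} => [|a L [L0 hL0]]; first by exists [::].
  have [L' hL'] := window a (g a) (hg a).
  exists (L0 ++ L') => L1 uL1 sL1 a1; rewrite inE => /predU1P[->|a1L] a'.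
    by apply: hL' => // b bL; apply: sL1; rewrite mem_cat bL orbT.
  by apply: hL0 => // b bL; apply: sL1; rewrite mem_cat bL.
move=> a aL; have : P L1 a (\sum_(b <- L) g b) = 0 by rewrite sg P0.
have -> : P L1 a (\sum_(b <- L) g b) = \sum_(b <- L) P L1 a (g b).
  by elim: (L) => [|b L' IHL]; rewrite ?big_nil ?P0 // !big_cons PD IHL.
rewrite (bigD1_seq a) //= hL1 // eqxx big_seq_cond big1 ?addr0 // => b /andP[bL ba].
by rewrite hL1 // eq_sym (negbTE ba).
Qed.

(** When |a| <= cM + cN, every splitting of a has |b| <= cM or |a - b| <= cN, so one factor of each
    pure tensor is zero. *)
Lemma tens_comp_bounded : bounded_below M -> bounded_below N ->
  exists c : int, forall a w, totdeg a <= c -> tens_comp a w -> w = 0.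
Proof.
move=> [cM hM] [cN hN]; exists (cM + cN) => a w ac.
elim=> // b x y v hx hy _ ->; rewrite addr0.
have [bM|bM] := lerP (totdeg b) cM.
  by move: hx; rewrite hM //= => ->; rewrite tens0l.
move: hy; rewrite hN /= => [->|]; first by rewrite tens0r.
rewrite -[X in X <= _]/(totdeg (a - b)) totdegD totdegN; lia.
Qed.

End GradedTensor.

(** * Acyclicity of free modules *)

Section DivisionByVariable.
Variables (K : fieldType) (n : nat).
Local Notation S := {mpoly K[n]}.
Implicit Types (p : S) (k l : 'I_n) (m : 'X_{1.. n}).

Lemma mnm1_le k m : (0 < m k)%N -> (U_(k) <= m)%MM.
Proof. by move=> mk; apply/mnm_lepP => i; rewrite mnm1E; case: eqP => [<-|]. Qed.

(** A K-linear left inverse of multiplication by X_k that drops the monomials not divisible by X_k.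
    It is not S-linear but commutes with the other variables, and it is locally nilpotent. *)
Definition mdivX k p : S :=
  \sum_(m <- msupp p) (if (0 < m k)%N then p@_m *: 'X_[m - U_(k)] else 0).

Lemma mcoeff_mdivX k p m : (mdivX k p)@_m = p@_(m + U_(k)).
Proof.
rewrite /mdivX raddf_sum /=.
rewrite (eq_bigr (fun m' => p@_m' *+ (m' == (m + U_(k))%MM))) => [|m' _].
  have [ms|ms] := boolP ((m + U_(k))%MM \in msupp p).
    rewrite (bigD1_seq _ ms) ?msupp_uniq //= eqxx big1 ?addr0 // => m' /negbTE->.
    by rewrite mulr0n.
  rewrite (memN_msupp_eq0 ms) big1_seq // => m' /andP[_ m's].
  by case: eqP ms m's => [->/negbTE->|].
case: ifPn => m'k.
  rewrite mcoeffZ mcoeffX -[RHS]mulr_natr; congr (_ * (nat_of_bool _)%:R).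
  by apply/eqP/eqP => [<-|->]; rewrite ?addmK // submK // mnm1_le.
rewrite mcoeff0; case: eqP m'k => // ->.
by rewrite mnmDE mnm1E eqxx addn1.
Qed.

Lemma mcoeffXM l p m :
  ('X_l * p)@_m = if (0 < m l)%N then p@_(m - U_(l)) else 0.
Proof.
rewrite mulrC; case: ifPn => ml; first by rewrite -{1}(submK (mnm1_le ml)) addmC mcoeffMX.
apply: memN_msupp_eq0; rewrite (perm_mem (msuppMX _ _)).
by apply/mapP => -[m' _ E]; move: ml; rewrite E mnmDE mnm1E eqxx.
Qed.

Lemma mdivX_linear k (a : K) p q : mdivX k (a%:MP * p + q) = a%:MP * mdivX k p + mdivX k q.
Proof.
by apply/mpolyP => m; rewrite !(mcoeffD, mcoeffCM, mcoeff_mdivX).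
Qed.

Lemma mdivX0 k : mdivX k 0 = 0.
Proof. by apply/mpolyP => m; rewrite mcoeff_mdivX !mcoeff0. Qed.

Lemma mdivXK k p : mdivX k ('X_k * p) = p.
Proof.
apply/mpolyP => m; rewrite mcoeff_mdivX mcoeffXM mnmDE mnm1E eqxx addn1 /=.
by rewrite addmK.
Qed.

Lemma mdivXC k l p : l != k -> mdivX k ('X_l * p) = 'X_l * mdivX k p.
Proof.
move=> lk; apply/mpolyP => m; rewrite mcoeff_mdivX !mcoeffXM mcoeff_mdivX.
have /negbTE kl : k != l by rewrite eq_sym.
rewrite mnmDE mnm1E kl addn0; case: ifP => // ml; congr (p@_ _).
apply/mnmP => i; rewrite !(mnmDE, mnmBE) addnBAC //.
exact: (mnm_lepP (mnm1_le ml)).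
Qed.

Lemma mdivX_nilp k p t : (msize p <= t)%N -> iter t (mdivX k) p = 0.
Proof.
move=> pt; apply/mpolyP => m; rewrite mcoeff0.
suff -> : (iter t (mdivX k) p)@_m = p@_(m + U_(k) *+ t).
  apply: memN_msupp_eq0; apply: msize_mdeg_ge; apply: leq_trans pt _.
  by rewrite mdegD mdegMn mdeg1 mul1n leq_addl.
elim: t m {pt} => [|t IHt] m; first by rewrite mulm0n addm0.
by rewrite iterS mcoeff_mdivX IHt mulmS addmA.
Qed.

Variable I : choiceType.
Local Notation F := {freeg I / S}.
Local Notation "M '_K'" := (restr_scalars (@mpolyC n K) M : lmodType K)
  (at level 2, format "M '_K'").

Definition fdivX k (D : F) : F := fgmap xpredT (mdivX k) D.

Lemma coeff_fdivX k D x : coeff x (fdivX k D) = mdivX k (coeff x D).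
Proof. by rewrite fgmap_f0_coeffE ?mdivX0. Qed.

Fact fdivX_linear k : linear (fdivX k : F _K -> F _K).
Proof.
move=> a D E; apply/eqP/freeg_eqP => x.
rewrite -[a *: D]/(a%:MP *: (D : F)) -[a *: (_ : F _K)]/(a%:MP *: (fdivX k D : F)).
by rewrite !(coeff_fdivX, coeffD, coeffZ) mdivX_linear.
Qed.

Definition fdiv k : {linear F _K -> F _K} :=
  HB.pack_for {linear F _K -> F _K} (fdivX k : F _K -> F _K)
    (GRing.isLinear.Build K (F _K) (F _K) *:%R _ (fdivX_linear k)).

Lemma fdivE k D : fdiv k D = fdivX k D.
Proof. by []. Qed.

Lemma fdivK k D : fdiv k (scal _ 'X_k D) = D.
Proof.
rewrite fdivE scalE; apply/eqP/freeg_eqP => x.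
by rewrite coeff_fdivX coeffZ mdivXK.
Qed.

Lemma fdivC k l D : l != k -> fdiv k (scal _ 'X_l D) = scal _ 'X_l (fdiv k D).
Proof.
move=> lk; rewrite !fdivE !scalE; apply/eqP/freeg_eqP => x.
by rewrite !(coeff_fdivX, coeffZ) mdivXC.
Qed.

Lemma fdiv_nilp k D : exists T, forall t, (T <= t)%N -> iter t (fdiv k) D = 0.
Proof.
exists (\max_(x <- dom D) msize (coeff x D))%N => t Tt.
have cE x : coeff x (iter t (fdiv k) D : F) = iter t (mdivX k) (coeff x D).
  by elim: t {Tt} => //= t IHt; rewrite coeff_fdivX IHt.
apply/eqP/freeg_eqP => x; rewrite cE coeff0.
have [xD|xD] := boolP (x \in dom D).
  by apply: mdivX_nilp; apply: leq_trans Tt; apply: leq_bigmax_seq.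
by rewrite (coeff_outdom xD) mdivX_nilp // msize0.
Qed.

Variable N : lmodType S.
Local Notation W := (tensor (F _K) (N _K)).

Definition tdiv k : {linear W -> W} := tmap (fdiv k) idfun.
(** The error term of dividing on the left: [tdiv k] composed with z_k is 1 minus this map, which is
    locally nilpotent because division lowers the left factor. *)
Definition tdiv_shift k : {linear W -> W} := tmap (fdiv k) (scal N 'X_k).

Lemma tdiv_zdiff k w : tdiv k (zdiff _ N k w) = w - tdiv_shift k w.
Proof.
rewrite zdiffE linearB /= /tdiv /actl /actr (tmap_triangle (f2 := idfun) (g2 := idfun)) //.
  by rewrite (tmap_triangle (f2 := fdiv k) (g2 := scal N 'X_k)) // tmap_id.
by move=> D; rewrite fdivK.
Qed.

Lemma tdiv_zdiffC k l w : l != k -> tdiv k (zdiff _ N l w) = zdiff _ N l (tdiv k w).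
Proof.
by move=> lk; apply: tmap_zdiff => // D; apply: fdivC.
Qed.

Lemma tdiv_shift_zdiffC k l w : l != k ->
  tdiv_shift k (zdiff _ N l w) = zdiff _ N l (tdiv_shift k w).
Proof.
move=> lk; apply: tmap_zdiff => [D|y]; first exact: fdivC.
by rewrite !scalE !scalerA mulrC.
Qed.

Lemma tdiv_shift_nilp k w :
  exists T, forall t, (T <= t)%N -> iter t (tdiv_shift k) w = 0.
Proof.
elim/tensor_ind: w => [|D y w [T hT]].
  by exists 0%N => t _; elim: t => //= t ->; rewrite linear0.
have [T' hT'] := fdiv_nilp k D; exists (maxn T T') => t.
rewrite geq_max => /andP[/hT Tt /hT' Tt'].
have -> : iter t (tdiv_shift k) (tens D y + w) =
    tens (iter t (fdiv k) D) (iter t (scal N 'X_k) y) + iter t (tdiv_shift k) w.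
  by elim: t {Tt Tt'} => //= t ->; rewrite linearD; congr (_ + _); apply: tmapE.
by rewrite Tt Tt' tens0l addr0.
Qed.

(** The geometric series of [tdiv_shift k] truncated at t terms and applied to [tdiv k]; composed
    with z_k it telescopes to 1 minus the t-th power of [tdiv_shift k]. *)
Fixpoint zdiff_inv k (t : nat) : {linear W -> W} :=
  if t is t'.+1 then tdiv k \+ (tdiv_shift k \o zdiff_inv k t') else \0.

Lemma zdiff_invS k t w :
  zdiff_inv k t.+1 w = tdiv k w + tdiv_shift k (zdiff_inv k t w).
Proof. by []. Qed.

Lemma zdiff_invK k t w :
  zdiff_inv k t (zdiff _ N k w) = w - iter t (tdiv_shift k) w.
Proof.
elim: t => [|t IHt]; first by rewrite subrr.
by rewrite zdiff_invS IHt tdiv_zdiff linearB addrA subrK.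
Qed.

Lemma zdiff_invC k l t w : l != k ->
  zdiff_inv k t (zdiff _ N l w) = zdiff _ N l (zdiff_inv k t w).
Proof.
move=> lk; elim: t => [|t IHt]; first by rewrite [RHS]linear0.
by rewrite !zdiff_invS IHt tdiv_zdiffC // tdiv_shift_zdiffC // linearD.
Qed.

Lemma koszul_free_acyclic i (f : {ffun {set 'I_n} -> W}) :
  ext_homog i.+1 f -> koszul (zdiff _ N) f = 0 ->
  exists2 g, ext_homog i.+2 g & koszul (zdiff _ N) g = f.
Proof.
apply: koszul_acyclic => [|k {}f]; first exact: zdiffC.
(* A form has finitely many coefficients, so the largest of their nilpotency bounds serves as a
   common truncation. *)
have [T hT] := choice (fun A => tdiv_shift_nilp k (f A)).
exists (zdiff_inv k (\max_A T A)); split=> [A|l w lk].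
  by rewrite zdiff_invK hT ?subr0 //; apply: leq_bigmax.
exact: zdiff_invC.
Qed.

End DivisionByVariable.

(** * From the tensor product over K to the one over S *)

Section BaseChange.
Variables (K : fieldType) (n : nat).
Local Notation S := {mpoly K[n]}.
Local Notation "M '_K'" := (restr_scalars (@mpolyC n K) M : lmodType K)
  (at level 2, format "M '_K'").

Section Projection.
Variables M N : lmodType S.
Local Notation W := (tensor (M _K) (N _K)).
Local Notation T := (tensor M N : lmodType S).

Fact tensor_proj_ex : exists h : {linear W -> T _K},
  forall (x : M) (y : N), h (tens (x : M _K) (y : N _K)) = tens x y.
Proof.
apply: tensor_lift_ex => [a x x' y|a x y y'].
  exact: (tens_linearl a%:MP (x : M) (x' : M) (y : N)).
exact: (tens_linearr a%:MP (x : M) (y : N) (y' : N)).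
Qed.

Definition tensor_proj (w : W) : T := sval (cid tensor_proj_ex) w.

Lemma tensor_projE (x : M) (y : N) :
  tensor_proj (tens (x : M _K) (y : N _K)) = tens x y.
Proof. exact: (svalP (cid tensor_proj_ex)). Qed.

Lemma tensor_proj0 : tensor_proj 0 = 0.
Proof. exact: raddf0. Qed.

Lemma tensor_projD v w : tensor_proj (v + w) = tensor_proj v + tensor_proj w.
Proof. exact: raddfD. Qed.

Lemma tensor_projB v w : tensor_proj (v - w) = tensor_proj v - tensor_proj w.
Proof. exact: raddfB. Qed.

Lemma tensor_projZ (c : K) w : tensor_proj (c *: w) = c%:MP *: tensor_proj w.
Proof. by rewrite /tensor_proj linearZ. Qed.

Lemma tensor_proj_sum (J : Type) (r : seq J) (F : J -> W) :
  tensor_proj (\sum_(j <- r) F j) = \sum_(j <- r) tensor_proj (F j).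
Proof. exact: raddf_sum. Qed.

Lemma tensor_proj_surj (u : T) : exists w, tensor_proj w = u.
Proof.
elim/tensor_ind: u => [|x y u [w wE]]; first by exists 0; exact: tensor_proj0.
exists (tens (x : M _K) (y : N _K) + w).
by rewrite tensor_projD tensor_projE wE.
Qed.

(** W as an S-module through its left factor, on a type of its own, so that its quotient by the
    image of the z_k is an S-module. *)
Definition tensor_left : Type := W.
HB.instance Definition _ := GRing.Zmodule.on tensor_left.

Definition left_scale (s : S) (w : tensor_left) : tensor_left := actl M N s w.

Fact left_scaleA s t w : left_scale s (left_scale t w) = left_scale (s * t) w.
Proof. by apply: tmap_triangle => // x; rewrite !scalE scalerA. Qed.

Fact left_scale1 : left_id 1 left_scale.
Proof. by move=> w; apply: tmap_id => // x; rewrite scalE scale1r. Qed.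

Fact left_scaleDr : right_distributive left_scale +%R.
Proof. by move=> s v w; rewrite /left_scale (raddfD (actl M N s)). Qed.

Fact left_scaleDl w : {morph left_scale^~ w : s t / s + t}.
Proof. by move=> s t; apply: tmapDl => x; rewrite !scalE scalerDl. Qed.

HB.instance Definition _ := GRing.Zmodule_isLmodule.Build S tensor_left
  left_scaleA left_scale1 left_scaleDr left_scaleDl.

Definition zdiff_im (w : W) : Prop :=
  exists u : 'I_n -> W, w = \sum_k zdiff M N k (u k).

Lemma zdiff_imD v w : zdiff_im v -> zdiff_im w -> zdiff_im (v + w).
Proof.
move=> [f ->] [g ->]; exists (fun k => f k + g k).
by rewrite -big_split; apply: eq_bigr => k _; rewrite zdiffD.
Qed.

Lemma actl_zdiff s k w : actl M N s (zdiff M N k w) = zdiff M N k (actl M N s w).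
Proof. by apply: tmap_zdiff => // x; rewrite !scalE !scalerA mulrC. Qed.

Lemma zdiff_im_actl s w : zdiff_im w -> zdiff_im (actl M N s w).
Proof.
move=> [f ->]; exists (fun k => actl M N s (f k)).
by rewrite (raddf_sum (actl M N s)); apply: eq_bigr => k _; apply: actl_zdiff.
Qed.

Fact zdiff_im_closed : submod_closed (fun w : tensor_left => `[< zdiff_im w >]).
Proof.
split=> [|s v w /asboolP hv /asboolP hw]; apply/asboolP.
  by exists (fun=> 0); rewrite big1 // => k _; rewrite zdiff0.
by apply: zdiff_imD => //; apply: zdiff_im_actl.
Qed.

Definition zdiff_submod : submodClosed tensor_left := mk_submod zdiff_im_closed.

Definition zdiff_balanced (s : S) : Prop :=
  forall w, zdiff_im (actl M N s w - actr M N s w).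

(** Modulo the common factors, st (x) 1 - 1 (x) st = (s (x) 1)(t (x) 1 - 1 (x) t) + (s (x) 1 - 1 (x)
    s)(1 (x) t). *)
Lemma zdiff_balancedM s t :
  zdiff_balanced s -> zdiff_balanced t -> zdiff_balanced (s * t).
Proof.
move=> hs ht w.
have -> : actl M N (s * t) w = actl M N s (actl M N t w).
  by apply/esym/tmap_triangle => // x; rewrite !scalE scalerA.
have -> : actr M N (s * t) w = actr M N s (actr M N t w).
  by apply/esym/tmap_triangle => // x; rewrite !scalE scalerA.
rewrite -(subrK (actl M N s (actr M N t w)) (actl M N s (actl M N t w))) -addrA.
apply: zdiff_imD; last exact: hs.
by rewrite -(raddfB (actl M N s)); apply/zdiff_im_actl/ht.
Qed.

Lemma zdiff_im0 : zdiff_im 0.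
Proof. by exists (fun=> 0); rewrite big1 // => k _; rewrite zdiff0. Qed.

Lemma zdiff_balancedC (c : K) : zdiff_balanced c%:MP.
Proof.
move=> w; suff -> : actl M N c%:MP w = actr M N c%:MP w by rewrite subrr; apply: zdiff_im0.
elim/tensor_ind: w => [|x y w IHw].
  by rewrite (raddf0 (actl M N _)) (raddf0 (actr M N _)).
rewrite (raddfD (actl M N _)) (raddfD (actr M N _)); congr (_ + _); last exact: IHw.
by rewrite /= actlE actrE -[LHS]/(tens (c *: (x : M _K)) _) tensZl -tensZr.
Qed.

Lemma zdiff_balancedX (k : 'I_n) : zdiff_balanced 'X_k.
Proof.
move=> w; exists (fun l => if l == k then w else 0).
rewrite (bigD1 k) //= big1 => [|l /negbTE->]; first by rewrite eqxx addr0.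
exact: (zdiff0 M N l).
Qed.

Lemma zdiff_balanced_all s : zdiff_balanced s.
Proof.
rewrite (mpolyE s); elim/big_ind: _ => [w|a b ha hb w|m _].
- rewrite -(mpolyC0 n); exact: zdiff_balancedC.
- have -> : actl M N (a + b) w = actl M N a w + actl M N b w.
    by apply: tmapDl => x; rewrite !scalE scalerDl.
  have -> : actr M N (a + b) w = actr M N a w + actr M N b w.
    elim/tensor_ind: w => [|x y w IHw].
      by rewrite !(raddf0 (actr M N _)) addr0.
    rewrite !(raddfD (actr M N _)) /= IHw !actrE scalerDl addrACA; congr (_ + _).
    exact: tensDr.
  by rewrite opprD addrACA; apply: zdiff_imD.
- rewrite -mul_mpolyC; apply: zdiff_balancedM; first exact: zdiff_balancedC.
  rewrite mpolyXE_id; elim/big_ind: _ => [|a b|k _].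
  + exact: (zdiff_balancedC 1).
  + exact: zdiff_balancedM.
  elim: (m k) => [|j IHj]; first by rewrite expr0; apply: (zdiff_balancedC 1).
  by rewrite exprS; apply: zdiff_balancedM => //; apply: zdiff_balancedX.
Qed.

Lemma tensor_proj_zdiff k w : tensor_proj (zdiff M N k w) = 0.
Proof.
elim/tensor_ind: w => [|x y w IHw].
  by rewrite zdiff0 tensor_proj0.
rewrite zdiffD tensor_projD IHw addr0.
rewrite zdiffE actlE actrE tensor_projB !tensor_projE.
apply/eqP; rewrite subr_eq0; apply/eqP.
exact: etrans (tensZl 'X_k (x : M) (y : N)) (esym (tensZr 'X_k (x : M) (y : N))).
Qed.

(** Modulo the image of the z_k the two S-actions on W agree, so x (x) y is S-bilinear there. The
    resulting map out of M (x)_S N, composed with the projection, is the quotient map, which bounds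
    the kernel. *)
Lemma tensor_proj_ker w : tensor_proj w = 0 <-> zdiff_im w.
Proof.
split=> [w0|[u ->]]; last first.
  rewrite tensor_proj_sum big1 // => k _; exact: tensor_proj_zdiff.
pose Q := quotmod zdiff_submod : lmodType S.
have [h hE] : exists h : {linear T -> Q}, forall x y,
    h (tens x y) = quotproj zdiff_submod (tens (x : M _K) (y : N _K)).
  apply: tensor_lift_ex => [s x x' y|s x y y'].
    rewrite -linearP; congr quotproj; apply: etrans (tensDl _ _ _) _.
    by congr (_ + _); exact/esym/actlE.
  apply/eqP; rewrite -linearP -subr_eq0 -linearB /= pi_quotmod_eq0.
  apply/asboolP; set xy := tens (x : M _K) (y : N _K).
  suff -> : tens (x : M _K) (s *: y + y' : N _K) -
      (s *: (xy : tensor_left) + tens (x : M _K) (y' : N _K) : tensor_left) =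
      - (actl M N s xy - actr M N s xy) :> W.
    have [u ->] := zdiff_balanced_all s xy; exists (fun k => - u k).
    by rewrite -sumrN; apply: eq_bigr => k _; exact/esym/(raddfN (zdiff M N k)).
  change (tens (x : M _K) (s *: y + y' : N _K) -
    (actl M N s xy + tens (x : M _K) (y' : N _K)) = - (actl M N s xy - actr M N s xy)).
  by rewrite tensDr opprD addrACA subrr addr0 opprB actrE.
have hproj v : h (tensor_proj v) = quotproj zdiff_submod v.
  elim/tensor_ind: v => [|x y v IHv].
    by rewrite tensor_proj0 !linear0.
  have hD : {morph h : a b / a + b} by exact: raddfD.
  have qD : {morph (quotproj zdiff_submod) : a b / a + b} by exact: raddfD.
  by rewrite tensor_projD hD IHv tensor_projE hE; exact/esym/qD.
have : quotproj zdiff_submod w == 0 by rewrite -hproj w0 linear0.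
by rewrite pi_quotmod_eq0 => /asboolP.
Qed.

End Projection.

Variables (M M' N : lmodType S) (f : {linear M -> M'}).

Lemma tensor_proj_map (w : tensor (M _K) (N _K)) :
  tensor_proj (tmap (restr_lin (@mpolyC n K) f) idfun w) =
  tensor_map f (tensor_proj w).
Proof.
elim/tensor_ind: w => [|x y w IHw].
  rewrite tmap0 !tensor_proj0; exact/esym/tensor_map0.
rewrite tmapD !tensor_projD IHw tensor_mapD; congr (_ + _).
by rewrite tmapE !tensor_projE tensor_map_tens.
Qed.

End BaseChange.

(** * Dimension shifting *)

Section Connecting.
Variables (K : fieldType) (n : nat) (U F V : lmodType K).
Variables (zU : 'I_n -> {linear U -> U}) (zF : 'I_n -> {linear F -> F})
  (zV : 'I_n -> {linear V -> V}).
Hypothesis zFC : forall k l w, zF k (zF l w) = zF l (zF k w).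
Variables (f : {linear U -> F}) (g : {linear F -> V}).
Variables (r : {linear F -> U}) (s : {linear V -> F}).
Hypothesis fz : forall k w, f (zU k w) = zF k (f w).
Hypothesis gz : forall k w, g (zF k w) = zV k (g w).
Hypothesis rf : forall w, r (f w) = w.
Hypothesis gs : forall w, g (s w) = w.
Hypothesis frsg : forall w, w = f (r w) + s (g w).

Lemma split_comp0 w : g (f w) = 0.
Proof.
have /eqP := frsg (f w); rewrite rf -subr_eq0 opprD addrA subrr sub0r oppr_eq0.
by move=> /eqP sg0; rewrite -(gs (g (f w))) sg0 linear0.
Qed.

Local Notation Om := (ext_map (n := n)).

Let rfO (w : {ffun {set 'I_n} -> U}) : Om r (Om f w) = w.
Proof. by apply/ffunP => A; rewrite !ffunE rf. Qed.

Let gsO (w : {ffun {set 'I_n} -> V}) : Om g (Om s w) = w.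
Proof. by apply/ffunP => A; rewrite !ffunE gs. Qed.

Let gfO (w : {ffun {set 'I_n} -> U}) : Om g (Om f w) = 0.
Proof. by apply/ffunP => A; rewrite !ffunE split_comp0. Qed.

Let fO0 (w : {ffun {set 'I_n} -> F}) : Om g w = 0 -> w = Om f (Om r w).
Proof.
move=> gw; apply/ffunP => A; rewrite !ffunE {1}(frsg (w A)).
by move/ffunP/(_ A): gw; rewrite !ffunE => ->; rewrite linear0 addr0.
Qed.

Hypothesis F_acyclic : forall i (w : {ffun {set 'I_n} -> F}),
  ext_homog i.+1 w -> koszul zF w = 0 -> koszul_boundary zF i.+1 w.

(** The connecting map: lift by s, differentiate, pull back by r. It is injective since F is acyclic
    in degree i + 1. The splitting need not commute with the z_k. That the image bounds in F is
    recorded for i = 0, where F need not be acyclic. *)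
Lemma connecting_indep i k (v : 'I_k -> {ffun {set 'I_n} -> V}) :
  (forall t, ext_homog i.+1 (v t) /\ koszul zV (v t) = 0) ->
  indep_mod (koszul_boundary zV i.+1) v ->
  exists u : 'I_k -> {ffun {set 'I_n} -> U},
    (forall t, [/\ ext_homog i (u t), koszul zU (u t) = 0 &
      koszul_boundary zF i (ext_map f (u t))]) /\
    indep_mod (koszul_boundary zU i) u.
Proof.
move=> hv v_indep; pose w t := Om s (v t).
have hw t : ext_homog i.+1 (w t) by apply/ext_map_homog/(hv t).1.
pose u t := Om r (koszul zF (w t)).
have fu t : Om f (u t) = koszul zF (w t).
  by apply/esym/fO0; rewrite -(koszul_map _ gz) gsO (hv t).2.
exists u; split=> [t|d [y hy yE] t].
  split; first by apply/ext_map_homog/koszul_homog.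
    rewrite -[koszul zU (u t)]rfO -(koszul_map _ fz) fu koszul_koszul //.
    by rewrite linear0.
  by exists (w t).
apply: v_indep.
have [||x hx xE] := @F_acyclic i (\sum_t d t *: w t - Om f y).
- apply: ext_homogB; last exact: ext_map_homog.
  by apply: ext_homog_sum => j _; apply: ext_homogZ.
- rewrite linearB /= (koszul_map _ fz) yE linear_sum linear_sum -sumrB /=.
  by rewrite big1 // => j _; rewrite !linearZ /= fu scalerN subrr.
exists (Om g x); first exact: ext_map_homog.
rewrite (koszul_map _ gz) xE linearB /= gfO subr0 linear_sum /=.
by apply: eq_bigr => j _; rewrite linearZ /= gsO.
Qed.

(** A class of U that dies in F as d w comes from the class of g w. If g w were d y, then w - d (s
    y) would come from U and bound u there. *)
Lemma connecting_nonzero i (u : {ffun {set 'I_n} -> U}) :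
  ext_homog i u -> koszul_boundary zF i (ext_map f u) ->
  ~ koszul_boundary zU i u ->
  exists v : {ffun {set 'I_n} -> V}, [/\ ext_homog i.+1 v, koszul zV v = 0 &
    ~ koszul_boundary zV i.+1 v].
Proof.
move=> hu [w hw wE] nu; exists (Om g w); split; first exact: ext_map_homog.
  by rewrite (koszul_map _ gz) wE gfO.
move=> [y hy yE]; apply: nu.
pose w' := w - koszul zF (Om s y).
have gw' : Om g w' = 0.
  by rewrite /w' linearB /= -(koszul_map _ gz) gsO yE subrr.
exists (Om r w').
  by apply/ext_map_homog/ext_homogB => //; apply/koszul_homog/ext_map_homog.
rewrite -[LHS]rfO -(koszul_map _ fz) -fO0 // /w' linearB /= koszul_koszul //.
by rewrite subr0 wE rfO.
Qed.

End Connecting.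

(** The section is linear although [t] is a mere choice: two preimages differ by some f u, which x -
    f (r x) does not see. *)
Lemma linear_splitting (K : fieldType) (U F V : lmodType K)
    (f : {linear U -> F}) (g : {linear F -> V}) :
  injective f -> (forall v, exists x, g x = v) ->
  (forall x, g x = 0 <-> exists u, f u = x) ->
  exists (r : {linear F -> U}) (s : {linear V -> F}),
    [/\ cancel f r, cancel s g & forall x, x = f (r x) + s (g x)].
Proof.
move=> fi gs exact_F; have [r rf] := linear_retraction fi.
have [t tP] := choice gs.
pose s v := t v - f (r (t v)).
have sE x : s (g x) = x - f (r x).
  have : g (t (g x) - x) = 0 by rewrite linearB tP subrr.
  move=> /exact_F[u uE]; rewrite /s; have -> : t (g x) = x + f u by rewrite uE addrC subrK.
  by rewrite !linearD /= rf addrACA subrr addr0.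
have gf u : g (f u) = 0 by apply/exact_F; exists u.
have s_lin : linear s.
  move=> a v w; rewrite -{1}(tP v) -{1}(tP w) -linearP sE /s [r _]linearP [f _]linearP /=.
  by rewrite scalerBr opprD addrACA.
exists r, (HB.pack_for {linear V -> F} s (GRing.isLinear.Build K V F *:%R _ s_lin)).
split=> // [v|x] /=; first by rewrite /s linearB /= gf subr0 tP.
by rewrite sE addrC subrK.
Qed.

(** * One step of the canonical resolution *)

Section FreeCover.
Variable R : comNzRingType.

(** [syzygy M j.+1] is convertible to [syz (syzygy M j)]; one step over an arbitrary module is what
    the dimension shift iterates. *)
Definition syz (V : lmodType R) : lmodType R := submod (ker_submod (free_cover V)).
Definition fr (V : lmodType R) : lmodType R := {freeg V / R}.
Definition syz_val (V : lmodType R) : {linear syz V -> fr V} := val.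
Definition fr_cover (V : lmodType R) : {linear fr V -> V} := free_cover V.

Lemma syz_val_inj (V : lmodType R) : injective (syz_val V).
Proof. exact: val_inj. Qed.

Lemma fr_cover_surj (V : lmodType R) (v : V) : exists x, fr_cover V x = v.
Proof. by exists << v >>; apply: free_cover_surj. Qed.

Lemma syz_exact (V : lmodType R) (x : fr V) :
  fr_cover V x = 0 <-> exists u, syz_val V u = x.
Proof.
split=> [/eqP x0|[u <-]]; first by exists (exist _ (x : {freeg V / R}) x0).
exact/eqP/(valP (u : submod (ker_submod (free_cover V)))).
Qed.

Variables M N : lmodType R.

Definition res_d j : {linear fr (syzygy M j.+1) -> fr (syzygy M j)} := free_res_d M j.

Lemma res_dE j (x : fr (syzygy M j.+1)) :
  syz_val (syzygy M j) (fr_cover (syzygy M j.+1) x) = res_d j x.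
Proof. by []. Qed.

Definition tens_d j :
    {linear tensor (fr (syzygy M j.+1)) N -> tensor (fr (syzygy M j)) N} :=
  tensor_map (res_d j).

Lemma TorS j : Tor M N j.+1 = homology_at (tens_d j.+1) (tens_d j).
Proof. by []. Qed.

Lemma Tor0 : Tor M N 0 = quotmod (im_submod (tens_d 0)).
Proof. by []. Qed.

End FreeCover.

Section HomologyClasses.
Variables (R : comNzRingType) (A B C : lmodType R).
Variables (f : {linear A -> B}) (g : {linear B -> C}).

Definition homology_class (b : B) (gb : g b = 0) : homology_at f g :=
  quotproj (boundary_submod f g) (exist _ b (introT eqP gb)).

Lemma homology_class_surj (x : homology_at f g) :
  exists b (gb : g b = 0), x = homology_class gb.
Proof.
elim/quotW: x => -[b gb]; have gb0 : g b = 0 by apply/eqP.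
exists b, gb0; rewrite /homology_class; congr (quotproj _ _).
exact: val_inj.
Qed.

Lemma homology_class_eq0 b (gb : g b = 0) :
  (exists a, f a = b) -> homology_class gb = 0.
Proof.
move=> [a fa]; apply/eqP; rewrite pi_quotmod_eq0.
by apply/asboolP; exists a.
Qed.

Lemma homology_class_sum_eq0 (k : nat) (c : 'I_k -> R) (b : 'I_k -> B)
    (gb : forall t, g (b t) = 0) :
  \sum_t c t *: homology_class (gb t) = 0 -> exists a, f a = \sum_t c t *: b t.
Proof.
pose e t : submod (ker_submod g) := exist _ (b t) (introT eqP (gb t)).
have -> : \sum_t c t *: homology_class (gb t) =
    quotproj (boundary_submod f g) (\sum_t c t *: e t).
  by rewrite linear_sum; apply: eq_bigr => t _; rewrite linearZ.
move=> /eqP; rewrite pi_quotmod_eq0 => /asboolP[a _ fa]; exists a.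
by rewrite fa (raddf_sum (val : {linear submod (ker_submod g) -> B})).
Qed.

Lemma cokernel_sum_eq0 (k : nat) (c : 'I_k -> R) (b : 'I_k -> B) :
  \sum_t c t *: quotproj (im_submod f) (b t) = 0 ->
  exists a, f a = \sum_t c t *: b t.
Proof.
have -> : \sum_t c t *: quotproj (im_submod f) (b t) =
    quotproj (im_submod f) (\sum_t c t *: b t).
  by rewrite linear_sum; apply: eq_bigr => t _; rewrite linearZ.
by move=> /eqP; rewrite pi_quotmod_eq0 => /asboolP[a _ fa]; exists a.
Qed.

End HomologyClasses.

(** * Tor as Koszul homology *)

Section TorKoszul.
Variables (K : fieldType) (n : nat).
Local Notation S := {mpoly K[n]}.
Local Notation "M '_K'" := (restr_scalars (@mpolyC n K) M : lmodType K)
  (at level 2, format "M '_K'").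
Variable N : lmodType S.

Lemma tmap_restr_zdiff (V V' : lmodType S) (f : {linear V -> V'}) (k : 'I_n)
    (w : tensor (V _K) (N _K)) :
  tmap (restr_lin (@mpolyC n K) f) idfun (zdiff V N k w) =
  zdiff V' N k (tmap (restr_lin (@mpolyC n K) f) idfun w).
Proof. by apply: tmap_zdiff => // x; rewrite !restr_linE !scalE linearZ. Qed.

Definition tensK (V : lmodType S) : lmodType K := tensor (V _K) (N _K).
Definition zK (V : lmodType S) (k : 'I_n) : {linear tensK V -> tensK V} := zdiff V N k.

Definition mapW (V V' : lmodType S) (f : {linear V -> V'}) :
  {linear tensK V -> tensK V'} := tmap (restr_lin (@mpolyC n K) f) idfun.

Local Notation W V := (tensK V).
Local Notation Omega V := {ffun {set 'I_n} -> W V}.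
Local Notation z V := (zK V).

Lemma mapW_zdiff (V V' : lmodType S) (f : {linear V -> V'}) k w :
  mapW f (z V k w) = z V' k (mapW f w).
Proof.
exact: (tmap_restr_zdiff f k w).
Qed.

Lemma mapW_comp (V V' V'' : lmodType S) (f : {linear V -> V'})
    (g : {linear V' -> V''}) (h : {linear V -> V''}) :
  (forall x, g (f x) = h x) -> forall w, mapW g (mapW f w) = mapW h w.
Proof. by move=> gf; apply: tmap_triangle. Qed.

Lemma zKC (V : lmodType S) k l w : z V k (z V l w) = z V l (z V k w).
Proof. exact: (@zdiffC K n V N k l w). Qed.

Lemma zK_free_acyclic (V : lmodType S) i (f : Omega (fr V)) :
  ext_homog i.+1 f -> koszul (z (fr V)) f = 0 -> koszul_boundary (z (fr V)) i.+1 f.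
Proof. exact: (@koszul_free_acyclic K n V N i f). Qed.

Definition coverW (V : lmodType S) : {linear W (fr V) -> W V} := mapW (fr_cover V).

Definition inclW (V : lmodType S) : {linear W (syz V) -> W (fr V)} :=
  mapW (syz_val V).

(** Over K the sequence of a free cover splits, and a split sequence stays split after tensoring
    with N over K. *)
Lemma syz_splitting (V : lmodType S) :
  exists (r : {linear W (fr V) -> W (syz V)}) (s : {linear W V -> W (fr V)}),
    [/\ forall w, r (inclW V w) = w, forall w, coverW V (s w) = w &
        forall w, w = inclW V (r w) + s (coverW V w)].
Proof.
pose i : {linear (syz V)_K -> (fr V)_K} := restr_lin _ (syz_val V).
pose p : {linear (fr V)_K -> V _K} := restr_lin _ (fr_cover V).
have i_inj : injective i := @syz_val_inj _ V.
have p_surj v : exists x, p x = v.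
  by have [x xv] := fr_cover_surj (v : V); exists x.
have exact_F x : p x = 0 <-> exists u, i u = x.
  have [F1 F2] := syz_exact (x : fr V); split=> [/F1[u ux]|[u ux]].
    by exists u.
  by apply: F2; exists u.
have [r [s [rf gs frsg]]] := linear_splitting i_inj p_surj exact_F.
exists (tmap r idfun), (tmap s idfun); split=> w.
- by rewrite (tmap_triangle (f2 := idfun) (g2 := idfun)) // tmap_id.
- by rewrite (tmap_triangle (f2 := idfun) (g2 := idfun)) // tmap_id.
rewrite (tmap_triangle (f2 := i \o r) (g2 := idfun)) //.
rewrite (tmap_triangle (f2 := s \o p) (g2 := idfun)) //.
by rewrite -(tmapDl (f := idfun)) ?tmap_id.
Qed.

Lemma cover_incl (V : lmodType S) w : coverW V (inclW V w) = 0.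
Proof.
have [r [s [rf gs frsg]]] := syz_splitting V.
exact: split_comp0 rf gs frsg w.
Qed.

Definition koszul_family i k (V : lmodType S) : Prop :=
  exists v : 'I_k -> Omega V,
    (forall t, ext_homog i (v t) /\ koszul (z V) (v t) = 0) /\
    indep_mod (koszul_boundary (z V) i) v.

Definition koszul_class i (V : lmodType S) : Prop :=
  exists v : Omega V, [/\ ext_homog i v, koszul (z V) v = 0 &
    ~ koszul_boundary (z V) i v].

Lemma koszul_family_connecting i k (V : lmodType S) (v : 'I_k -> Omega V) :
  (forall t, ext_homog i.+1 (v t) /\ koszul (z V) (v t) = 0) ->
  indep_mod (koszul_boundary (z V) i.+1) v ->
  exists u : 'I_k -> Omega (syz V),
    (forall t, [/\ ext_homog i (u t), koszul (z (syz V)) (u t) = 0 &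
      koszul_boundary (z (fr V)) i (ext_map (inclW V) (u t))]) /\
    indep_mod (koszul_boundary (z (syz V)) i) u.
Proof.
have [r [s [rf gs frsg]]] := syz_splitting V.
apply: (@connecting_indep K n _ _ _ (z (syz V)) (z (fr V)) (z V) _ (inclW V)
  (coverW V) r s) => //.
- exact: zKC.
- exact: mapW_zdiff.
- exact: mapW_zdiff.
- exact: zK_free_acyclic.
Qed.

Lemma koszul_class_connecting i (V : lmodType S) (u : Omega (syz V)) :
  ext_homog i u -> koszul_boundary (z (fr V)) i (ext_map (inclW V) u) ->
  ~ koszul_boundary (z (syz V)) i u -> koszul_class i.+1 V.
Proof.
have [r [s [rf gs frsg]]] := syz_splitting V.
apply: (@connecting_nonzero K n _ _ _ (z (syz V)) (z (fr V)) (z V) _ (inclW V)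
  (coverW V) r s) => //.
- exact: zKC.
- exact: mapW_zdiff.
- exact: mapW_zdiff.
Qed.

Lemma koszul_family_shift i k V : koszul_family i.+1 k V -> koszul_family i k (syz V).
Proof.
move=> [v [hv v_indep]]; have [u [hu u_indep]] := koszul_family_connecting hv v_indep.
by exists u; split=> // t; have [] := hu t.
Qed.

(** In positive exterior degree the free cover is acyclic, so every cycle over the syzygy dies in
    it. In degree 0 this has to be supplied separately. *)
Lemma koszul_class_shift i V : koszul_class i.+1 (syz V) -> koszul_class i.+2 V.
Proof.
move=> [u [hu zu nu]]; apply: (koszul_class_connecting hu _ nu).
apply: zK_free_acyclic; first exact: (ext_map_homog (inclW V) hu).
have := koszul_map u (mapW_zdiff (syz_val V)).
by rewrite zu linear0.
Qed.

Variable M : lmodType S.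

Lemma koszul_family_syzygy i k j :
  koszul_family (i + j) k M -> koszul_family i k (syzygy M j).
Proof.
elim: j i => [|j IHj] i; first by rewrite addn0.
by rewrite addnS -addSn => /IHj/koszul_family_shift.
Qed.

Lemma koszul_class_syzygy i j :
  koszul_class i.+1 (syzygy M j) -> koszul_class (i.+1 + j) M.
Proof.
elim: j i => [|j IHj] i; first by rewrite addn0.
by move=> /koszul_class_shift/IHj; rewrite addSn addnS.
Qed.

(** Chains of the resolution live over [fr V], so classes of degree 0 are lifted through the cover.
    The slack [w] absorbs the boundaries of the resolution, which the cover kills. *)
Lemma koszul_family_lift k (V : lmodType S) (v : 'I_k -> Omega V) :
  (forall t, ext_homog 0 (v t)) -> indep_mod (koszul_boundary (z V) 0) v ->
  exists q : 'I_k -> W (fr V),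
    (forall t, coverW V (q t) = v t finset.set0) /\
    forall (d : 'I_k -> K) w, coverW V w = 0 ->
      koszul_im (z (fr V)) (\sum_t d t *: q t - w) -> forall t, d t = 0.
Proof.
move=> hv v_indep; have [r [s [_ gs _]]] := syz_splitting V.
exists (fun t => s (v t finset.set0)); split=> [t|d w w0 [u uE]]; first exact: gs.
apply: (v_indep d); pose f := \sum_t d t *: v t.
have hf : ext_homog 0 f by apply: ext_homog_sum => t _; apply: ext_homogZ.
suff fim : koszul_im (z V) (f finset.set0) by exact: (koszul_im_ex hf fim).
exists (fun k => coverW V (u k)).
have -> : \sum_k z V k (coverW V (u k)) = coverW V (\sum_k z (fr V) k (u k)).
  by rewrite linear_sum; apply: eq_bigr => j _; rewrite [RHS]mapW_zdiff.
rewrite -uE linearB /= w0 subr0 linear_sum sum_ffunE; apply: eq_bigr => t _.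
by rewrite ffunE linearZ /= gs.
Qed.

(** Lifting the witnesses by s corrects q to an element killed by the cover; this comes from
    [syz V], and in turn from the free cover of [syz V]. *)
Lemma cover_im (V : lmodType S) (q : W (fr V)) : koszul_im (z V) (coverW V q) ->
  exists w, koszul_im (z (fr V)) (q - inclW V (coverW (syz V) w)).
Proof.
move=> [c cE]; have [r [s [_ gs frsg]]] := syz_splitting V.
pose b := \sum_k z (fr V) k (s (c k)).
have bq : coverW V (q - b) = 0.
  have cb : coverW V b = \sum_k z V k (c k).
    by rewrite linear_sum; apply: eq_bigr => k _; rewrite [LHS]mapW_zdiff gs.
  have cD : coverW V (q - b) = coverW V q - coverW V b by exact: linearB.
  by rewrite cD cE cb subrr.
have [_ [s' [_ gs' _]]] := syz_splitting (syz V).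
exists (s' (r (q - b))), (fun k => s (c k)); rewrite gs'.
rewrite -/b; move: (frsg (q - b)); rewrite bq linear0 addr0 => <-.
by rewrite opprB addrC subrK.
Qed.

Lemma res_d_map j w :
  mapW (res_d M j) w = inclW (syzygy M j) (coverW (syzygy M j.+1) w).
Proof.
exact: (esym (@mapW_comp (fr (syzygy M j.+1)) (syz (syzygy M j))
  (fr (syzygy M j)) (fr_cover (syzygy M j.+1)) (syz_val (syzygy M j)) (res_d M j)
  (@res_dE _ M j) w)).
Qed.

Lemma cover_res_d_map j w : coverW (syzygy M j) (mapW (res_d M j) w) = 0.
Proof. by rewrite res_d_map cover_incl. Qed.

Definition projW (V : lmodType S) (w : W V) : tensor V N := tensor_proj w.

Lemma projW_surj (V : lmodType S) (u : tensor V N) : exists w : W V, projW w = u.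
Proof. exact: tensor_proj_surj u. Qed.

Lemma projW_ker (V : lmodType S) (w : W V) : projW w = 0 <-> koszul_im (z V) w.
Proof. exact: tensor_proj_ker w. Qed.

Lemma projWB (V : lmodType S) (v w : W V) : projW (v - w) = projW v - projW w.
Proof. exact: tensor_projB v w. Qed.

Lemma projW_sumZ (V : lmodType S) k (c : 'I_k -> K) (w : 'I_k -> W V) :
  projW (\sum_t c t *: w t) = \sum_t (c t)%:MP *: projW (w t).
Proof.
apply: etrans (tensor_proj_sum _ _) _; apply: eq_bigr => t _.
exact: tensor_projZ.
Qed.

Lemma projW_map (V V' : lmodType S) (f : {linear V -> V'}) (w : W V) :
  projW (mapW f w) = tensor_map f (projW w).
Proof. exact: tensor_proj_map f w. Qed.

Local Notation d j := (tens_d M N j).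

Lemma projW_res_d j w : projW (mapW (res_d M j) w) = d j (projW w).
Proof. exact: (projW_map (res_d M j) w). Qed.

Definition indep_family (T : lmodType S) (k : nat) : Prop := exists x : 'I_k -> T,
  forall c : 'I_k -> K, \sum_t (c t)%:MP_[n] *: x t = 0 -> forall t, c t = 0.

(** Tor_(j+1) is the kernel of the map from the syzygy j + 1 to the free module F_j after tensoring
    with N. After j shifts the classes have exterior degree 1, and one more connecting map lands in
    that kernel. *)
Lemma tor_family_of_koszul i k : koszul_family i k M -> indep_family (Tor M N i) k.
Proof.
case: i => [|j]; [rewrite Tor0|rewrite TorS].
  move=> M_family; have [v [hv v_indep]] : koszul_family 0 k (syzygy M 0) := M_family.
  have [q [qv q_indep]] := koszul_family_lift (fun t => (hv t).1) v_indep.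
  exists (fun t => quotproj (im_submod (d 0%N)) (projW (q t))) => c c0.
  have [a aE] := @cokernel_sum_eq0 _ _ _ (d 0%N) k (fun t => (c t)%:MP) _ c0.
  have [w wa] := projW_surj (V := fr (syzygy M 1)) a.
  apply: (q_indep c (mapW (res_d M 0) w)); first exact: cover_res_d_map.
  apply/projW_ker; rewrite projWB projW_sumZ.
  apply/eqP; rewrite subr_eq0; apply/eqP.
  rewrite projW_res_d wa; refine (esym (etrans aE _)); reflexivity.
move=> M_family.
have [v [hv v_indep]] : koszul_family 1 k (syzygy M j).
  by apply: koszul_family_syzygy; rewrite add1n.
have [u [hu u_indep]] := koszul_family_connecting hv v_indep.
have hu0 t : ext_homog 0 (u t) by have [] := hu t.
have [q [qu q_indep]] := @koszul_family_lift k (syzygy M j.+1) u hu0 u_indep.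
(* The image of u t over the free module is a Koszul boundary, so it vanishes in the tensor product
   over S. *)
have dq t : d j (projW (q t)) = 0.
  rewrite -projW_res_d; apply/projW_ker.
  rewrite res_d_map qu; have [_ _ [y hy yE]] := hu t.
  have -> : inclW (syzygy M j) (u t finset.set0) = koszul (z _) y finset.set0.
    by rewrite yE ffunE.
  exact: koszul_im_homog1.
exists (fun t => homology_class (d j.+1) (dq t)) => c c0.
have [a aE] := homology_class_sum_eq0 (c := fun t => (c t)%:MP) c0.
have [w wa] := projW_surj (V := fr (syzygy M j.+2)) a.
apply: (q_indep c (mapW (res_d M j.+1) w)); first exact: cover_res_d_map.
apply/projW_ker; rewrite projWB projW_sumZ.
apply/eqP; rewrite subr_eq0; apply/eqP.
rewrite projW_res_d wa; refine (esym (etrans aE _)); reflexivity.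
Qed.

(** A Tor cycle gives a class of exterior degree 0 over the syzygy j + 1 that dies in the free
    module; by [cover_im] it can bound only if the Tor class is zero. One connecting map yields
    degree 1 over the syzygy j, and j shifts reach M. *)
Lemma koszul_class_of_tor j : (exists x : Tor M N j.+1, x != 0) ->
  koszul_class j.+1 M.
Proof.
rewrite TorS => -[x]; have [b [db ->]] := homology_class_surj x => /eqP nx.
rewrite -add1n; apply: koszul_class_syzygy.
have [q qb] := projW_surj (V := fr (syzygy M j.+1)) b.
have [u [hu u0]] := ext_homog0_ex n (coverW (syzygy M j.+1) q).
apply: (@koszul_class_connecting 0 (syzygy M j) u hu).
  have hi := ext_map_homog (inclW (syzygy M j)) hu.
  apply: (koszul_im_ex hi); rewrite ffunE u0.
  have -> : inclW (syzygy M j) (coverW (syzygy M j.+1) q) = mapW (res_d M j) q.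
    by rewrite res_d_map.
  by apply/projW_ker; rewrite projW_res_d qb.
move=> u_bdry; apply: nx; apply: homology_class_eq0.
have [y hy yE] : koszul_boundary (z (syzygy M j.+1)) 0 u := u_bdry.
have cq : koszul_im (z (syzygy M j.+1)) (coverW (syzygy M j.+1) q).
  by have := koszul_im_homog1 (z (syzygy M j.+1)) hy; rewrite yE u0.
have [w qw] : exists w, koszul_im (z (fr (syzygy M j.+1)))
    (q - inclW (syzygy M j.+1) (coverW (syzygy M j.+2) w)) := cover_im cq.
exists (projW w); rewrite -qb -projW_res_d; apply/eqP.
rewrite eq_sym -subr_eq0 -projWB; apply/eqP/projW_ker.
by rewrite res_d_map.
Qed.

End TorKoszul.

(** * The dimension bound for Tor *)

Section GradedTor.
Variables (K : fieldType) (n : nat).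
Local Notation S := {mpoly K[n]}.

Lemma dimK_ge_indep_family (T : lmodType S) k : indep_family T k -> dimK_ge T k.
Proof.
move=> [x x_indep]; pose y t : restr_scalars (@mpolyC n K) T := x t.
exact: (@dim_ge_free K (restr_scalars (@mpolyC n K) T) k y x_indep).
Qed.

Lemma indep_family1 (T : lmodType S) (x : T) : x != 0 -> indep_family T 1.
Proof.
move=> /eqP nx; exists (fun=> x) => c; rewrite big_ord1 => c0 t.
rewrite (ord1 t); apply/eqP; apply: contrapT => /negP cn0; apply: nx.
rewrite -[x]scale1r -(mpolyC1 n) -(mulVf cn0) mpolyCM -scalerA c0.
exact: scaler0.
Qed.

Variables M N : grmod K n.
Hypotheses (hM : bounded_below M) (hN : bounded_below N).

Lemma koszul_family_count p i : koszul_class N p M -> koszul_family N i 'C(p, i) M.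
Proof.
move=> [v [hv zv nv]]; have [c hc] := tens_comp_bounded hM hN.
have [a ha] := @koszul_nonzero_ex K n _ (zK N M) (@tens_comp K n M N)
  (@tens_comp0 K n M N) (@tens_compD K n M N) (@tens_compZ K n M N)
  (@tens_comp_zdiff K n M N) (@tens_comp_span K n M N) (@tens_comp_direct K n M N)
  p v hv zv nv.
have [L [uL <- hL]] := @koszul_nonzero_count K n _ (zK N M) (@zKC K n N M)
  (@tens_comp K n M N)
  (@tens_comp0 K n M N) (@tens_compD K n M N) (@tens_compZ K n M N)
  (@tens_comp_zdiff K n M N) c hc p a ha i.
exact: (@koszul_nonzero_indep K n _ (zK N M) (@tens_comp K n M N)
  (@tens_comp0 K n M N) (@tens_compD K n M N) (@tens_compZ K n M N)
  (@tens_comp_zdiff K n M N) (@tens_comp_span K n M N) (@tens_comp_direct K n M N)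
  i L uL hL).
Qed.

End GradedTor.

Theorem theorem1p1 (K : fieldType) (n : nat) (M N : grmod K n)
    (hM : bounded_below M) (hN : bounded_below N) (p : nat)
    (hp : exists x : Tor M N p, x != 0) (i : nat) (hi : (i <= p)%N) :
  dimK_ge (Tor M N i) 'C(p, i).
Proof.
apply: dimK_ge_indep_family; case: p => [|p] in hp hi *.
  (* For p = 0 only i = 0 occurs and the bound is 1, given by the nonzero element itself. Above
     that, [koszul_class_of_tor] needs a positive index. *)
  case: i hi => [|//] _; have [x nx] := hp; exact: indep_family1 nx.
apply/tor_family_of_koszul/koszul_family_count => //.
exact: koszul_class_of_tor.
Qed.
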